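(* Let $d \in \mathbb{N}$, $a \in \mathbb{R}$, $b \in (a,\infty)$, let $(\Omega,\mathcal{F},\mathbb{P})$ be a probability space, and let $X_{n,m}\colon \Omega \to [a,b]^d$, $(n,m) \in \mathbb{Z}^2$, be i.i.d. random variables such that for all $x \in [a,b]^d$ and all $\varepsilon \in (0,1)$ it holds that $\mathbb{P}(\|X_{0,0}-x\| < \varepsilon) > 0$. Let $\mathfrak{l}\colon \mathbb{R}^d\times\mathbb{R}^d\to\mathbb{R}$ satisfy $\mathfrak{l}(\theta,x) = \|\theta - x\|^2$ for all $\theta,x\in\mathbb{R}^d$. Let $M,\mathfrak{M}\in\mathbb{N}$ and let $\Theta\colon \mathbb{N}_0\times\Omega\to\mathbb{R}^d$ and $\gamma\colon\mathbb{N}\times\Omega\to\mathbb{R}$ be stochastic processes such that for all $n\in\mathbb{N}$ $$\Theta_n = \Theta_{n-1} - \frac{\gamma_n}{M}\Big[\sum_{m=1}^M (\nabla_\theta \mathfrak{l})(\Theta_{n-1}, X_{n,m})\Big].$$ Assume that $(X_{n,m})_{(n,m)\in\mathbb{Z}^2}$ and $\Theta_0$ are independent and that $\mathbb{E}[\|\Theta_0\|^2]<\infty$. Let $(\nu_n)_{n\in\mathbb{N}}\subseteq(0,1)$ be strictly decreasing with $\sum_{n=1}^\infty \nu_n = \infty$ and $\limsup_{n\to\infty}\nu_n = 0$. Assume $\gamma_1 = \nu_1$ and for all $n\in\mathbb{N}$ $$\gamma_{n+1} = \begin{cases} \gamma_n & \text{if } \sum_{m=1}^{\mathfrak{M}}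 \mathfrak{l}(\Theta_n, X_{n,-m}) \le \sum_{m=1}^{\mathfrak{M}} \mathfrak{l}(\Theta_{n-1}, X_{n,-m}),\\ \max\big((0,\gamma_n)\cap \{\nu_k\colon k\in\mathbb{N}\}\big) & \text{if } \sum_{m=1}^{\mathfrak{M}} \mathfrak{l}(\Theta_n, X_{n,-m}) > \sum_{m=1}^{\mathfrak{M}} \mathfrak{l}(\Theta_{n-1}, X_{n,-m}).\end{cases}$$ For every $t\in[0,\infty)$ let $N_t = \inf\{n\in\mathbb{N}_0\colon \sum_{k=1}^n \gamma_k \ge t\}$. Then $$\limsup_{t\to\infty}\mathbb{E}\big[\|\Theta_{N_t} - \mathbb{E}[X_{1,1}]\|\big] = 0.$$
   Context: $\|\cdot\|$ denotes the Euclidean norm; $\nabla_\theta\mathfrak{l}$ is the gradient with respect to the first argument. *)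

(* Defs.v *)
From HB Require Import structures.
From mathcomp Require Import all_boot all_order all_algebra.
From mathcomp Require Import all_classical all_reals all_analysis.
Set Implicit Arguments. Unset Strict Implicit. Unset Printing Implicit Defensive.
Import Order.TTheory GRing.Theory Num.Theory.
Import numFieldNormedType.Exports.
Local Open Scope classical_set_scope.
Local Open Scope ring_scope.

Section Defs.
Variable R : realType.

Definition enorm (d : nat) (v : 'rV[R]_d) : R :=
  Num.sqrt (\sum_(i < d) (v ord0 i) ^+ 2).

Definition grad1 (d : nat) (f : 'rV[R]_d -> 'rV[R]_d -> R)
  (theta x : 'rV[R]_d) : 'rV[R]_d :=
  \row_(i < d) 'D_(delta_mx ord0 i) (fun t => f t x) theta.

Definition rV_borel (d : nat) : set (set 'rV[R]_d) :=
  <<s [set A | exists (i : 'I_d) (B : set R),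
          measurable B /\ A = (fun v : 'rV[R]_d => v ord0 i) @^-1` B] >>.

Definition rv_sigma (T : Type) (d : nat) (Y : T -> 'rV[R]_d) : set (set T) :=
  [set Y @^-1` B | B in @rV_borel d].

Definition random_vector (dT : measure_display) (T : measurableType dT)
  (d : nat) (Y : T -> 'rV[R]_d) : Prop :=
  forall B, @rV_borel d B -> measurable (Y @^-1` B).

Definition mutually_independent (dT : measure_display) (T : measurableType dT)
  (P : probability T R) (I : eqType) (F : I -> set (set T)) : Prop :=
  forall (J : seq I) (A : I -> set T), uniq J ->
    (forall i, i \in J -> F i (A i)) ->
    P (\bigcap_(i in [set i | i \in J]) A i) = (\prod_(i <- J) P (A i))%E.

Definition independent2 (dT : measure_display) (T : measurableType dT)
  (P : probability T R) (F G : set (set T)) : Prop :=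
  forall A B, F A -> G B -> P (A `&` B) = (P A * P B)%E.

(* first n in N_0 with sum_{k=1}^n g k >= t (0 if none; this never happens
   under the hypotheses of the theorem) *)
Definition first_hit (g : nat -> R) (t : R) : nat :=
  match pselect (exists n, `[< t <= \sum_(1 <= k < n.+1) g k >]) with
  | left h => @ex_minn (fun n => `[< t <= \sum_(1 <= k < n.+1) g k >]) h
  | right _ => 0%N
  end.

End Defs.

(* Main.v *)
(* Write D_n = Theta_n - E[X], S_n = gamma_1 + ... + gamma_n and c = 4 (1 - nu_1).
   The gradient step reads D_n = (1 - 2 gamma_n) D_(n-1) + 2 gamma_n xi_n with a bounded
   noise xi_n that is centered and independent of the past.

   Since (1 - 2 g)^2 <= exp (- c g) for 0 < g <= nu_1, the energy exp (c S_n) |D_n|^2 is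
   bounded by |D_0|^2 plus a martingale plus a multiple of the sum of exp (c S_k) gamma_k^2.
   The step sizes dominate nu, so N_t is bounded by a deterministic time and the stopped
   martingale has mean zero; the last sum is at most a constant depending on n0 plus
   K gamma_n0 exp (c t), because exp (c S_k) gamma_k is dominated by an increment of
   exp (c S_k).  Dividing by exp (c t) leaves K E[gamma_n0], for every n0.

   It remains to see that gamma_n tends to 0 almost surely, i.e. that it drops infinitely
   often.  If the step size were eventually constant, Theta would stay bounded.  By the second
   Borel-Cantelli lemma there are then infinitely many time blocks in which the training
   samples are close to the corner (a, ..., a) for a long time and jump to (b, ..., b) at
   the last step, while the validation samples of that step are close to (a, ..., a); at
   the end of such a block every coordinate of the validation loss increases, which forces a
   drop. *)

Require Import Defs.
From HB Require Import structures.
From mathcomp Require Import all_boot all_order all_algebra.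
From mathcomp Require Import all_classical all_reals all_analysis.
From mathcomp Require Import measurable_realfun.
From mathcomp Require Import zify ring lra.
Import Order.TTheory GRing.Theory Num.Theory.
Import numFieldNormedType.Exports.
Local Open Scope classical_set_scope.
Local Open Scope ring_scope.
Set Implicit Arguments.
Unset Strict Implicit.

(** Independence on rectangles makes the law of the pair [(phi, Y)] a product measure, and Fubini
    then integrates [Y] first, against a factor that is constant in it. The target [T'] is arbitrary
    so that [phi] may be the identity into [T] with a smaller sigma-algebra. *)
Lemma integral_mul_indep_centered (R : realType) d d' (T : measurableType d)
    (T' : measurableType d') (P : probability T R) (phi : T -> T') (Y : T -> R)
    (G : T' -> R) (C : R) :
  measurable_fun setT phi -> measurable_fun setT Y -> measurable_fun setT G ->
  (forall w, `|Y w| <= C) -> (\int[P]_w (Y w)%:E = 0)%E ->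
  P.-integrable setT (EFin \o (G \o phi)) ->
  (forall A B, measurable A -> measurable B ->
     P (phi @^-1` A `&` Y @^-1` B) = (P (phi @^-1` A) * P (Y @^-1` B))%E) ->
  P.-integrable setT (fun w => (G (phi w) * Y w)%:E) /\
  (\int[P]_w (G (phi w) * Y w)%:E = 0)%E.
Proof.
move=> mphi mY mG YC Y0 iG ind.
have iYG : P.-integrable setT (fun w => (G (phi w) * Y w)%:E).
  have := (@integrableMl _ _ _ P setT measurableT (EFin \o (G \o phi)) Y iG mY); apply => /=.
  exists `|C|; split; first exact: num_real.
  by move=> x xC w _ /=; apply: le_trans (YC w) _; apply: le_trans (ltW xC); exact: ler_norm.
split => //.
have iY : P.-integrable setT (EFin \o Y).
  apply: (@le_integrable _ _ _ P setT measurableT _ (EFin \o cst C)).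
  - exact/measurable_EFinP.
  - by move=> w _ /=; rewrite lee_fin (le_trans (YC w)) ?ler_norm.
  - exact: finite_measure_integrable_cst.
pose phi' : {mfun T >-> T'} := HB.pack phi (isMeasurableFun.Build _ _ _ _ phi mphi).
pose Y' : {mfun T >-> R} := HB.pack Y (isMeasurableFun.Build _ _ _ _ Y mY).
have mpY : measurable_fun setT (fun w => (phi w, Y w)).
  exact: measurable_fun_pair.
pose H : {mfun T >-> (T' * R)%type} :=
  HB.pack (fun w => (phi w, Y w)) (isMeasurableFun.Build _ _ _ _ _ mpY).
pose f (z : T' * R) := (G z.1 * z.2)%:E.
have mf : measurable_fun setT f.
  apply/measurable_EFinP/measurable_funM; last exact: measurable_snd.
  by apply: measurableT_comp => //; exact: measurable_fst.
have prodE : forall A, measurable A ->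
    (distribution P phi' \x distribution P Y')%E A = distribution P H A.
  move=> A mA; apply: product_measure_unique => //.
transitivity (\int[distribution P H]_z f z)%E.
  by rewrite (integral_distribution (X:=H) mf).
transitivity (\int[(distribution P phi' \x distribution P Y')%E]_z f z)%E.
  by apply: eq_measure_integral => A mA _; exact/esym/prodE.
(* Fubini asks for integrability under the product measure; it comes from [iYG], read first under
   the law of the pair. *)
rewrite -integral12_prod_meas1; last first.
  have iH : (distribution P H).-integrable setT f.
    exact: (@integrable_pushforward _ _ _ _ _ H mpY P setT f).
  apply/integrableP; split => //; move/integrableP : iH => [_].
  apply: le_lt_trans; rewrite le_eqVlt; apply/orP; left; apply/eqP.
  by apply: eq_measure_integral => A mA _; exact: prodE.
rewrite integral0_eq// => x _; rewrite /fubini_F /f /=.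
under eq_integral do rewrite EFinM.
have iYi : (distribution P Y').-integrable setT EFin.
  exact: (@integrable_pushforward _ _ _ _ _ Y' mY P setT EFin).
by rewrite integralZl// integral_distribution//= Y0 mule0.
Qed.

(** * Independence and the centered noise *)

Section Past.
Context (R : realType) d (T : measurableType d) (P : probability T R) (I : choiceType).
Variables (F : I -> set (set T)) (F0 : set (set T)) (J : seq I).
Hypotheses (FT : forall i, F i setT) (F0T : F0 setT).
Hypotheses (FI : forall i, setI_closed (F i)) (F0I : setI_closed F0).

(* With a fixed finite list J of indices these sets form a pi-system. *)
Definition past_cylinder : set (set T) :=
  [set C | exists E A, [/\ F0 E, forall i, i \in J -> F i (A i) &
     C = E `&` \bigcap_(i in [set i | i \in J]) A i]].

Lemma past_cylinder_setI : setI_closed past_cylinder.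
Proof.
move=> _ _ [E [A [E0 FA ->]]] [E' [A' [E'0 FA' ->]]].
exists (E `&` E'), (fun i => A i `&` A' i); split.
- exact: F0I.
- by move=> i iJ; apply: FI; [exact: FA|exact: FA'].
- by rewrite bigcapI setIACA.
Qed.

Lemma past_cylinder_base E : F0 E -> past_cylinder E.
Proof.
move=> E0; exists E, (fun=> setT); split => //.
by apply/seteqP; split => [w Ew|w []//]; split.
Qed.

Lemma past_cylinder_proj i B : i \in J -> F i B -> past_cylinder B.
Proof.
move=> iJ FB; exists setT, (fun k => if k == i then B else setT); split => //.
  by move=> k _; case: eqP => [->|].
rewrite setTI; apply/seteqP; split => [w Bw k _|w]; first by case: ifP.
by move=> /(_ i iJ); rewrite eqxx.
Qed.

Hypotheses (Fm : forall i, F i `<=` measurable) (F0m : F0 `<=` measurable).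

Lemma past_cylinder_measurable : past_cylinder `<=` measurable.
Proof.
move=> _ [E [A [E0 FA ->]]]; apply: measurableI; first exact: F0m.
by rewrite bigcap_seq big_seq; apply: bigsetI_measurable => i iJ; exact/Fm/FA.
Qed.

(** For fixed [B], both [P (C]&[B)] and [P B * P C] are finite measures in [C]. They agree on the
    pi-system of cylinders, hence on the sigma-algebra it generates. *)
Lemma past_cylinder_indep (j : I) : uniq J -> j \notin J ->
  mutually_independent P F -> independent2 P <<s \bigcup_(i in setT) F i >> F0 ->
  forall C B, <<s past_cylinder >> C -> F j B -> P (C `&` B) = (P C * P B)%E.
Proof.
move=> uJ jJ mi i2 C B sC FB.
have mB : measurable B by exact: Fm FB.
have PBf : P B \is a fin_num by exact: fin_num_measure.
have PB0 : (0 <= fine (P B))%R by rewrite fine_ge0.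
rewrite -[in RHS](fineK PBf) muleC.
have H : forall A, <<s past_cylinder >> A ->
   (mrestr P mB) A = (mscale (NngNum PB0) P) A.
  apply: (g_sigma_algebra_measure_unique past_cylinder past_cylinder_measurable
     (fun=> setT)).
  - by move=> _; exact: past_cylinder_base.
  - by rewrite bigcup_const//; exists 0%N.
  - exact: past_cylinder_setI.
  - move=> _ [E [A [E0 FA ->]]].
    suff : P (E `&` \bigcap_(i in [set i | i \in J]) A i `&` B) =
        (P B * P (E `&` \bigcap_(i in [set i | i \in J]) A i))%E.
      by rewrite -[in X in _ = X -> _](fineK PBf).
    (* Placing [B] at the new index [j] turns the intersection with [B] into a single intersection
       over [j :: J], to which mutual independence applies. *)
    pose A' i := if i == j then B else A i.
    have A'E : {in J, A' =1 A}.
      by move=> i iJ; rewrite /A'; case: eqP => // ij; rewrite -ij iJ in jJ.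
    have FA' i : i \in j :: J -> F i (A' i).
      by rewrite inE /A'; case: eqP => [->|_] //= /FA.
    have sub (K : seq I) : {subset K <= j :: J} ->
        <<s \bigcup_(i in setT) F i >> (\bigcap_(i in [set i | i \in K]) A' i).
      move=> KJ; rewrite bigcap_seq big_seq.
      apply: (@bigsetI_measurable _ (g_sigma_algebraType (\bigcup_(i in setT) F i))) => i iK.
      by apply: sub_sigma_algebra; exists i => //; apply/FA'/KJ.
    have AA' : \bigcap_(i in [set i | i \in J]) A i = \bigcap_(i in [set i | i \in J]) A' i.
      by apply: eq_bigcapr => i /= iJ; rewrite A'E.
    have AB : \bigcap_(i in [set i | i \in J]) A i `&` B =
        \bigcap_(i in [set i | i \in j :: J]) A' i.
      by rewrite AA' !bigcap_seq big_cons {2}/A' eqxx setIC.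
    (* Split off [E], factor over [j :: J], detach the factor of [B], then reassemble the cylinder
       over [J]. *)
    rewrite -setIA AB setIC (i2 _ _ (sub _ (fun _ h => h)) E0).
    rewrite mi/= ?jJ//; rewrite big_cons {1}/A' eqxx.
    rewrite setIC AA' (i2 _ _ (sub J _) E0)//; last first.
      by move=> i iJ; rewrite inE iJ orbT.
    rewrite mi// ?muleA// => i iJ; apply: FA'; by rewrite inE iJ orbT.
  - by move=> _ /=; rewrite /mrestr setTI ltey_eq PBf.
exact: H.
Qed.

End Past.

(** * Second Borel-Cantelli lemma for independent blocks *)

Section BlockBorelCantelli.
Context (R : realType) d (T : measurableType d) (P : probability T R) (I : choiceType).
Variables (F : I -> set (set T)) (A : I -> set T).
Hypotheses (Fm : forall i, F i `<=` measurable) (FA : forall i, F i (A i)).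
Hypothesis mi : mutually_independent P F.

Let B (J : seq I) := \bigcap_(i in [set i | i \in J]) A i.

Let mB J : measurable (B J).
Proof.
by rewrite /B bigcap_seq; apply: bigsetI_measurable => i _; exact/Fm/FA.
Qed.

Let PB J : uniq J -> P (B J) = (\prod_(i <- J) P (A i))%E.
Proof. by move=> uJ; apply: mi => // i _; exact: FA. Qed.

Let PBcat J J' : uniq (J ++ J') -> P (B (J ++ J')) = (P (B J) * P (B J'))%E.
Proof.
by move=> u; move: (u); rewrite cat_uniq => /and3P[u1 _ u2]; rewrite !PB// big_cat.
Qed.

Variable J_ : nat -> seq I.
Hypothesis uJ : forall k, uniq (J_ k).
Hypothesis dJ : forall k k' i, i \in J_ k -> i \in J_ k' -> k = k'.

(* The extra block J makes the induction on N go through: B J minus B (J_ k) is removed by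
   absorbing J_ k into J. *)
Lemma prob_avoid_blocks n N J : uniq J ->
  (forall k i, (n <= k < n + N)%N -> i \in J -> i \notin J_ k) ->
  P (B J `&` \big[setI/setT]_(n <= k < n + N) ~` B (J_ k)) =
  (P (B J) * (\prod_(n <= k < n + N) (1 - fine (P (B (J_ k)))))%:E)%E.
Proof.
elim: N J => [|N IH] J uniqJ disj.
  by rewrite addn0 !big_geq// setIT mule1.
rewrite addnS !big_nat_recr ?leq_addr//=.
set V := \big[setI/setT]_(n <= k < n + N) ~` B (J_ k).
have mV : measurable V by apply: bigsetI_measurable => k _; exact: measurableC.
have -> : B J `&` (V `&` ~` B (J_ (n + N)%N)) = (B J `&` V) `\` B (J_ (n + N)%N).
  by rewrite setIA setDE.
rewrite measureD//; last 2 first.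
- exact: measurableI.
- by rewrite ltey_eq fin_num_measure//; exact: measurableI.
have disj' k i : (n <= k < n + N)%N -> i \in J -> i \notin J_ k.
  by move=> /andP[nk kN]; apply: disj; rewrite nk addnS ltnS ltnW.
have -> : B J `&` V `&` B (J_ (n + N)%N) = B (J ++ J_ (n + N)%N) `&` V.
  by rewrite setIAC; congr (_ `&` _); rewrite /B !bigcap_seq big_cat.
have ucat : uniq (J ++ J_ (n + N)%N).
  rewrite cat_uniq uniqJ uJ andbT /=; apply/hasPn => i iN; apply/negP => iJ.
  have := disj (n + N)%N i _ iJ.
  by rewrite leq_addr addnS ltnSn iN => /(_ isT).
have fP K : P (B K) = (fine (P (B K)))%:E by rewrite fineK ?fin_num_measure.
have E1 := IH J uniqJ disj'.
have E2 : P (B (J ++ J_ (n + N)%N) `&` V) = (P (B (J ++ J_ (n + N)%N)) *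
    (\prod_(n <= k < n + N) (1 - fine (P (B (J_ k)))))%:E)%E.
  apply: IH => // k i kN; rewrite mem_cat => /orP[|iN]; first exact: disj'.
  apply/negP => ik; have := dJ ik iN => kE.
  by move: kN; rewrite kE ltnn andbF.
transitivity (P (B J `&` V) - P (B (J ++ J_ (n + N)%N) `&` V))%E; first by [].
rewrite E1 E2 PBcat// (fP J) (fP (J_ (n+N)%N)) -!EFinM -EFinB /=.
by congr EFin; ring.
Qed.

(** Missing all blocks from [n] to [n + N - 1] has probability at most [(1 - q) ^+ N] for every [N],
    so missing all blocks from [n] on is a null event; the exceptional set is the union of these
    events over [n]. *)
Lemma block_borel_cantelli (q : R) : 0 < q ->
  (forall k, q <= fine (P (B (J_ k)))) ->
  \forall w \ae P, forall n, exists k, (n <= k)%N /\ forall i, i \in J_ k -> A i w.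
Proof.
move=> q0 qP.
pose V n := \bigcap_(k in [set k | (n <= k)%N]) ~` B (J_ k).
have mV n : measurable (V n).
  by apply: bigcap_measurableType => k _; exact: measurableC.
suff V0 n : P (V n) = 0%E.
  exists (\bigcup_n V n); split.
  - exact: bigcupT_measurable.
  - apply: measure_negligible; first exact: bigcupT_measurable.
    by apply: negligible_bigcup => n; apply/negligibleP; [exact: mV|exact: V0].
  - move=> w /= /existsNP[n nw]; exists n => // k /= nk Bk.
    by apply: nw; exists k; split.
have q1 : q <= 1.
  by apply: (le_trans (qP 0%N)); rewrite -lee_fin fineK ?fin_num_measure// probability_le1.
have le N : (P (V n) <= ((1 - q) ^+ N)%:E)%E.
  (* The auxiliary block is taken empty, which leaves only the product over the avoided blocks. *)
  have BN : B [::] = setT by rewrite /B bigcap_seq big_nil.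
  have := @prob_avoid_blocks n N [::] isT.
  rewrite BN probability_setT setTI mul1e => /(_ (fun _ _ _ => _)) E.
  apply: (@le_trans _ _ (P (\big[setI/setT]_(n <= k < n + N) ~` B (J_ k)))).
    apply: le_measure; rewrite ?inE//.
      by apply: bigsetI_measurable => k _; exact: measurableC.
    move=> w Vw; rewrite big_nat; elim/big_ind : _ => //.
    by move=> k /andP[nk _]; exact: Vw.
  rewrite E ?lee_fin//.
  rewrite -[in leRHS](addKn n N) -prodr_const_nat; apply: ler_prod => k _.
  rewrite lerB// andbT subr_ge0 -lee_fin fineK ?fin_num_measure//.
  exact: probability_le1.
apply/eqP; rewrite eq_le measure_ge0 andbT; apply/lee_addgt0Pr => e e0.
rewrite add0e.
have /cvgrPdist_lt /(_ e e0) [N _ /(_ N (leqnn N))] : (1 - q) ^+ n @[n --> \oo] --> (0 : R).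
  by apply: cvg_expr; rewrite ger0_norm ?subr_ge0// ltrBlDr ltrDl.
rewrite /= sub0r normrN => lee; apply: (le_trans (le N)).
by rewrite lee_fin; apply/ltW; apply: le_lt_trans lee; exact: ler_norm.
Qed.

End BlockBorelCantelli.

(** * Pathwise estimates *)

(** A level reached at some [L] excludes the default value of [first_hit]. *)
Lemma first_hitP (R : realType) (g : nat -> R) (t : R) (L : nat) :
  t <= \sum_(1 <= k < L.+1) g k ->
  t <= \sum_(1 <= k < (first_hit g t).+1) g k /\
  forall n, t <= \sum_(1 <= k < n.+1) g k -> (first_hit g t <= n)%N.
Proof.
move=> tL; rewrite /first_hit; case: pselect => [h|[]]; last first.
  by exists L; apply/asboolP.
case: ex_minnP => m /asboolP mP mmin; split => // n tn.
by apply: mmin; apply/asboolP.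
Qed.

(** * Energy estimate along a single path *)

Section Recursion.
Context (R : realType) (I : finType).
Variables (g : nat -> R) (D xi : nat -> I -> R) (v C : R).
Hypothesis v1 : v < 1.
Hypothesis gv : forall n, (0 < n)%N -> 0 < g n <= v.
Hypothesis gmon : forall n m, (0 < n <= m)%N -> g m <= g n.
Hypothesis DE : forall n i, D n.+1 i = (1 - 2 * g n.+1) * D n i + 2 * g n.+1 * xi n.+1 i.
Hypothesis xiC : forall n i, `|xi n i| <= C.

Let S n := \sum_(1 <= k < n.+1) g k.
Let c := 4 * (1 - v).
(** This constant compares [expR (c * S n.+1) * g n.+1] with the increment of [expR (c * S n)]. *)
Let K := expR c / c.
Let B := #|I|%:R * C ^+ 2.
Let Q n := \sum_i D n i ^+ 2.
Let Mart n := \sum_(1 <= k < n.+1) \sum_i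
  (expR (c * S k) * (4 * g k * (1 - 2 * g k)) * D k.-1 i) * xi k i.
Let Rem n := \sum_(1 <= k < n.+1) expR (c * S k) * g k ^+ 2.

Let SS n : S n.+1 = S n + g n.+1.
Proof. by rewrite /S big_nat_recr. Qed.

Let S0 : S 0 = 0.
Proof. by rewrite /S big_geq. Qed.

Let gpos n : 0 < g n.+1.
Proof. by have /andP[] := gv (ltn0Sn n). Qed.

Let glev n : g n.+1 <= v.
Proof. by have /andP[] := gv (ltn0Sn n). Qed.

Let c0 : 0 < c.
Proof. by rewrite /c mulr_gt0// subr_gt0. Qed.

Let Smon : {homo S : n m / (n <= m)%N >-> n <= m}.
Proof.
apply: homo_leq => [//|x y z|n]; first exact: le_trans.
by rewrite SS lerDl ltW.
Qed.

Let Sle n : S n <= n%:R.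
Proof.
elim: n => [|n IH]; first by rewrite S0.
rewrite SS -natr1 lerD//; apply: (le_trans (glev n)); exact: ltW.
Qed.

(** Squaring the recursion gives a contracted part, a cross term and a squared noise term. The
    exponential weight compensates the contraction, the cross terms form [Mart], and the squared
    noise is at most [B]. *)
Lemma energy_bound n : expR (c * S n) * Q n <= Q 0 + Mart n + 4 * B * Rem n.
Proof.
elim: n => [|n IH].
  by rewrite S0 mulr0 expR0 mul1r /Mart /Rem !big_geq// mulr0 !addr0.
rewrite /Mart /Rem !(big_nat_recr n.+1)//= -/(Mart n) -/(Rem n).
set G := g n.+1; set e := expR (c * S n.+1).
have e0 : 0 < e by exact: expR_gt0.
have QE : Q n.+1 = (1 - 2 * G) ^+ 2 * Q n + 4 * G * (1 - 2 * G) *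
    (\sum_i D n i * xi n.+1 i) + 4 * G ^+ 2 * \sum_i xi n.+1 i ^+ 2.
  rewrite /Q !mulr_sumr -!big_split /=; apply: eq_bigr => i _.
  rewrite DE -/G; ring.
have xiB : \sum_i xi n.+1 i ^+ 2 <= B.
  rewrite /B -sum1_card natr_sum mulr_suml; apply: ler_sum => i _.
  by rewrite mul1r -[leLHS]real_normK ?num_real// lerXn2r ?nnegrE// (le_trans _ (xiC n.+1 i)).
have Q0 : 0 <= Q n by apply: sumr_ge0 => i _; exact: sqr_ge0.
have contr : e * ((1 - 2 * G) ^+ 2 * Q n) <= expR (c * S n) * Q n.
  rewrite mulrA ler_wpM2r// /e SS -/G mulrDr expRD -mulrA ger_pMr ?expR_gt0//.
  (* Since [G <= v], the left side [1 - 4 * G * (1 - G)] is at most [1 - c * G]. *)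
  have h : (1 - 2 * G) ^+ 2 <= expR (- (c * G)).
    apply: le_trans (expR_ge1Dx _).
    have := gpos n; have := glev n; rewrite -/G /c; nra.
  have := ler_wpM2l (expR_ge0 (c * G)) h.
  by rewrite -expRD subrr expR0.
have -> : \sum_i e * (4 * G * (1 - 2 * G)) * D n i * xi n.+1 i =
    e * (4 * G * (1 - 2 * G) * \sum_i D n i * xi n.+1 i).
  by rewrite !mulr_sumr; apply: eq_bigr => i _; ring.
have last : e * (4 * G ^+ 2 * \sum_i xi n.+1 i ^+ 2) <= 4 * B * (e * G ^+ 2).
  rewrite [leRHS](_ : _ = e * (4 * G ^+ 2 * B)); last by ring.
  by rewrite ler_pM2l// ler_wpM2l// mulr_ge0// sqr_ge0.
rewrite QE !mulrDr; lra.
Qed.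

(** The first [n0] terms are each at most [expR (c * n0%:R)], because [S k <= k] and steps are below
    1. In later terms one factor of the step is at most [g n0], and the rest telescopes. *)
Lemma remainder_bound n n0 : (0 < n0)%N ->
  Rem n <= n0%:R * expR (c * n0%:R) + g n0 * K * expR (c * S n).
Proof.
move=> n00.
have K0 : 0 <= g n0 * K.
  by rewrite mulr_ge0 ?divr_ge0 ?expR_ge0 ?ltW//; have /andP[] := gv n00.
(* Strengthened for the induction: [minn n n0] counts the crudely bounded terms, and [- 1] makes the
   bound vanish at [n = 0]. *)
suff : Rem n <= (minn n n0)%:R * expR (c * n0%:R) + g n0 * K * (expR (c * S n) - 1).
  move/le_trans; apply; rewrite mulrBr mulr1 addrA lerBlDr.
  rewrite -[leLHS]addr0 lerD// lerD2r ler_wpM2r ?expR_ge0// ler_nat; exact: geq_minr.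
elim: n => [|n IH].
  by rewrite /Rem big_geq// S0 mulr0 expR0 subrr mulr0 min0n mul0r addr0.
rewrite /Rem big_nat_recr//= -/(Rem n).
have gn0 := gpos n.
have g1 : g n.+1 <= 1 by apply: (le_trans (glev n)); exact: ltW.
have incr : expR (c * S n) <= expR (c * S n.+1) by rewrite ler_expR ler_pM2l// Smon.
have [nn0|nn0] := ltnP n n0.
  have -> : minn n.+1 n0 = (minn n n0).+1.
    by rewrite (minn_idPl nn0) (minn_idPl (ltnW nn0)).
  have h1 : expR (c * S n.+1) * g n.+1 ^+ 2 <= expR (c * n0%:R).
    rewrite -[leRHS]mulr1; apply: ler_pM; rewrite ?expR_ge0 ?sqr_ge0//.
      rewrite ler_expR ler_pM2l//; apply: (le_trans (Sle _)).
      by rewrite ler_nat.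
    by rewrite exprn_ile1// ltW.
  have h2 : g n0 * K * expR (c * S n) <= g n0 * K * expR (c * S n.+1) by rewrite ler_wpM2l.
  rewrite -natr1 mulrDl mul1r; lra.
have -> : minn n.+1 n0 = minn n n0.
  by rewrite (minn_idPr (leqW nn0)) (minn_idPr nn0).
suff : expR (c * S n.+1) * g n.+1 ^+ 2 <= g n0 * K * (expR (c * S n.+1) - expR (c * S n)).
  by move=> h; lra.
have gg : g n.+1 <= g n0 by apply: gmon; rewrite n00 leqW.
(* The increment is at least [expR (c * S n) * (c * g n.+1)], and steps below 1 change the
   exponential by a factor of at most [expR c]. *)
have key : expR (c * S n.+1) * g n.+1 <= K * (expR (c * S n.+1) - expR (c * S n)).
  have e1 : expR (c * S n.+1) <= expR c * expR (c * S n).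
    by rewrite -expRD ler_expR SS mulrDr addrC lerD2r -[leRHS]mulr1 ler_pM2l.
  have e2 : expR (c * S n) * (c * g n.+1) <= expR (c * S n.+1) - expR (c * S n).
    rewrite lerBrDr SS mulrDr expRD -{2}[expR (c * S n)]mulr1 -mulrDr.
    by rewrite ler_wpM2l ?expR_ge0// addrC expR_ge1Dx.
  have c1 : c != 0 by rewrite gt_eqF.
  apply: (@le_trans _ _ (K * (expR (c * S n) * (c * g n.+1)))).
    rewrite [leRHS](_ : _ = expR c * expR (c * S n) * g n.+1); last by rewrite /K; field.
    by rewrite ler_pM2r.
  by rewrite ler_wpM2l// /K divr_ge0 ?expR_ge0// ltW.
rewrite expr2 mulrA mulrC -[leRHS]mulrA; apply: ler_pM => //; first exact: ltW.
by rewrite mulr_ge0 ?expR_ge0// ltW.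
Qed.

(** The indicator of [S k.-1 < t] selects the steps up to the hitting time. It rewrites the stopped
    martingale as a sum over the fixed range up to [L], with coefficients that do not involve the
    noise of their own step. *)
Lemma stopped_energy_bound (t : R) n0 L : 0 <= t -> (0 < n0)%N -> t <= S L ->
  Q (first_hit g t) <= expR (- (c * t)) * (Q 0 +
      (\sum_(1 <= k < L.+1) \sum_i ((S k.-1 < t)%R%:R *
         (expR (c * S k) * (4 * g k * (1 - 2 * g k))) * D k.-1 i) * xi k i) +
      4 * B * (n0%:R * expR (c * n0%:R))) + 4 * B * K * expR c * g n0.
Proof.
move=> t0 n00 tL; have [tN Nmin] := first_hitP tL.
set N := first_hit g t in tN Nmin *.
have NL : (N <= L)%N by exact: Nmin.
have chiE k : (0 < k)%N -> (S k.-1 < t) = (k <= N)%N.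
  case: k => // k _ /=; apply/idP/idP => [Skt|kN].
    by rewrite ltnNge; apply/negP => Nk; move: Skt; rewrite ltNge (le_trans tN) ?Smon.
  by rewrite ltNge; apply/negP => /Nmin; rewrite leqNgt kN.
(* The sum before the last step is below [t] and that step is below 1; this overshoot costs the
   factor [expR c] in the conclusion. *)
have SN : S N <= t + 1.
  case: (posnP N) => [->|N0]; first by rewrite S0 addr_ge0.
  have := chiE N N0; rewrite leqnn -{2}(prednK N0) SS prednK// => /ltW h.
  rewrite lerD//; have /andP[_ h1] := gv N0; apply: (le_trans h1); exact: ltW.
set M := (X in _ + X + _).
have ME : M = Mart N.
  rewrite /M (big_cat_nat (n := N.+1))//= [X in _ + X]big_nat [X in _ + X]big1 ?addr0.
    rewrite /Mart big_nat [RHS]big_nat; apply: eq_bigr => k /andP[k0 kN].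
    by apply: eq_bigr => i _; rewrite chiE// -ltnS kN mul1r.
  move=> k /andP[Nk _]; rewrite big1// => i _.
  by rewrite chiE ?(leq_trans _ Nk)// leqNgt Nk !mul0r.
have en := energy_bound N; have re := remainder_bound N n00.
have B0 : 0 <= B by rewrite mulr_ge0 ?sqr_ge0.
have K0 : 0 <= K by rewrite /K divr_ge0 ?expR_ge0// ltW.
have gn0 : 0 <= g n0 by have /andP[/ltW] := gv n00.
have Q0 : 0 <= Q N by apply: sumr_ge0 => i _; exact: sqr_ge0.
have h : expR (c * t) * Q N <= Q 0 + M + 4 * B * (n0%:R * expR (c * n0%:R)) +
    expR (c * t) * (4 * B * K * expR c * g n0).
  have h1 : expR (c * t) * Q N <= expR (c * S N) * Q N.
    by rewrite ler_wpM2r// ler_expR ler_pM2l.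
  have h2 : 4 * B * Rem N <= 4 * B * (n0%:R * expR (c * n0%:R) + g n0 * K * expR (c * S N)).
    by rewrite ler_wpM2l// mulr_ge0.
  have h3 : 4 * B * (g n0 * K * expR (c * S N)) <= expR (c * t) * (4 * B * K * expR c * g n0).
    rewrite [leRHS](_ : _ = 4 * B * (g n0 * K * (expR (c * t) * expR c))); last by ring.
    apply: ler_wpM2l; first exact: mulr_ge0.
    apply: ler_wpM2l; first exact: mulr_ge0.
    rewrite -expRD ler_expR.
    by rewrite -[X in _ + X]mulr1 -mulrDr ler_pM2l.
  rewrite ME; lra.
have := ler_wpM2l (expR_ge0 (- (c * t))) h.
by rewrite mulrDr !(mulrA (expR (- (c * t))) (expR (c * t))) -expRD addNr expR0 !mul1r.
Qed.

End Recursion.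

(** Samples near [a] pull [u] geometrically close to [a]; one sample near [b] then pushes it away
    from [y], which is also near [a]. The tolerance depends on [G], [a], [b] only, while the waiting
    time [r] also depends on the initial bound [R0]. *)
Lemma constant_step_increase (R : realType) (G a b : R) : 0 < G < 1 -> a < b ->
  exists2 eps : R, 0 < eps < 1 & forall R0 : R, exists r : nat,
  forall (u x : nat -> R) (y : R),
    `|u 0 - a| <= R0 ->
    (forall k, (k <= r)%N -> u k.+1 = (1 - 2 * G) * u k + 2 * G * x k) ->
    (forall k, (k < r)%N -> `|x k - a| <= eps) ->
    `|x r - b| <= eps -> `|y - a| <= eps ->
    (u r - y) ^+ 2 < (u r.+1 - y) ^+ 2.
Proof.
move=> /andP[G0 G1] ab.
pose q := `|1 - 2 * G|.
have q1 : q < 1 by rewrite /q ltr_norml; apply/andP; split; lra.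
have q0 : 0 <= q by exact: normr_ge0.
(* [kap * eps] is the fixed point of the error recursion [e -> q * e + 2 * G * eps]. *)
pose kap := 2 * G / (1 - q).
have kap0 : 0 < kap by rewrite divr_gt0 ?mulr_gt0 ?subr_gt0.
pose eta := G * (b - a) / 4.
have eta0 : 0 < eta by rewrite divr_gt0 ?mulr_gt0 ?subr_gt0.
pose eps := Num.min (1 / 2) (eta / (2 * (kap + 1))).
have eps0 : 0 < eps.
  rewrite lt_min; apply/andP; split; first lra.
  by apply: divr_gt0 => //; apply: mulr_gt0 => //; exact: addr_gt0.
have epsle : kap * eps + eps <= eta / 2.
  rewrite -[X in _ + X]mul1r -mulrDl.
  have : eps <= eta / (2 * (kap + 1)) by rewrite ge_min lexx orbT.
  rewrite ler_pdivlMr ?mulr_gt0 ?addr_gt0// => h.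
  rewrite ler_pdivlMr//; lra.
exists eps.
  by rewrite eps0 /=; have : eps <= 1 / 2 by [rewrite ge_min lexx]; move=> ?; lra.
move=> R0.
have [r hr] : exists r, q ^+ r * R0 <= eta / 2.
  have : q ^+ n * R0 @[n --> \oo] --> 0 * R0.
    by apply: cvgMl; apply: cvg_expr; rewrite ger0_norm.
  rewrite mul0r => /cvgrPdist_le /(_ (eta / 2)) [|N _ /(_ N (leqnn N))]; first by rewrite divr_gt0.
  rewrite /= sub0r normrN => h; exists N; apply: le_trans h; exact: ler_norm.
exists r => u x y u0 uE xa xb ya.
have ur k : (k <= r)%N -> `|u k - a| <= q ^+ k * R0 + kap * eps.
  elim: k => [_|k IH kr].
    by rewrite expr0 mul1r (le_trans u0)// lerDl mulr_ge0// ltW.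
  have -> : u k.+1 - a = (1 - 2 * G) * (u k - a) + 2 * G * (x k - a).
    by rewrite uE 1?ltnW//; ring.
  apply: (le_trans (ler_normD _ _)); rewrite !normrM -/q exprS.
  have h1 := ler_wpM2l q0 (IH (ltnW kr)).
  have h2 : `|2| * `|G| * `|x k - a| <= 2 * G * eps.
    by rewrite ger0_norm// [`|G|]gtr0_norm// ler_pM2l ?mulr_gt0// xa.
  have h3 : q * (kap * eps) + 2 * G * eps = kap * eps.
    by rewrite /kap; field; rewrite subr_eq0 gt_eqF.
  lra.
have := ur r (leqnn r) => h.
have hh : `|u r - a| + eps <= eta by lra.
have := uE r (leqnn r); move: hh xb ya; rewrite /eta => hh xb ya ->.
have hn : eps + eps <= 2 * eps by lra.
move: hh; have := ler_norm (u r - a); have := ler_norm (a - u r).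
rewrite -[`|a - u r|]normrN opprB.
move: xb ya; rewrite !ler_norml => /andP[xb1 xb2] /andP[ya1 ya2] ua1 ua2 hh.
set U := u r in ua1 ua2 hh *; set e := `|U - a| in ua1 ua2 hh.
rewrite -subr_gt0.
(* In the second factor, [2 * G * (x r - U)] is at least [3 / 2 * G * (b - a)], whereas
   [2 * (U - y)] is at least [- 2 * eta], that is [- G * (b - a) / 2]. *)
have -> : ((1 - 2 * G) * U + 2 * G * x r - y) ^+ 2 - (U - y) ^+ 2 =
   2 * G * (x r - U) * (2 * (U - y) + 2 * G * (x r - U)) by ring.
have ba : 0 < b - a by rewrite subr_gt0.
have Gba : G * (b - a) < b - a by rewrite gtr_pMl.
have xU : (b - a) * (3 / 4) <= x r - U by lra.
have xU0 : 0 < x r - U by apply: lt_le_trans xU; rewrite mulr_gt0.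
apply: mulr_gt0; first by rewrite !mulr_gt0.
have := ler_wpM2l (ltW G0) xU.
have Gba0 : 0 < G * (b - a) by rewrite mulr_gt0.
lra.
Qed.

(** [C / (1 - q)] is the fixed point of [x -> q * x + C], so any bound above it is preserved. *)
Lemma geometric_bounded (R : realType) (u : nat -> R) (q C : R) :
  0 <= q < 1 -> (forall n, u n.+1 <= q * u n + C) ->
  forall n, u n <= Num.max (u 0) (C / (1 - q)).
Proof.
move=> /andP[q0 q1] uE; elim=> [|n IH]; first by rewrite le_max lexx.
apply: (le_trans (uE n)).
set m := Num.max _ _ in IH *.
have : C / (1 - q) <= m by rewrite le_max lexx orbT.
rewrite ler_pdivrMr ?subr_gt0// => h.
have := ler_wpM2l q0 IH; lra.
Qed.

Lemma limn_esup0_lt (R : realType) (nu : nat -> R) :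
  limn_esup (fun n => (nu n)%:E) = 0%E ->
  forall e : R, 0 < e -> exists N, forall n, (N <= n)%N -> nu n < e.
Proof.
move=> nu0 e e0.
have : (limn_esup (fun n => (nu n)%:E) < e%:E)%E by rewrite nu0 lte_fin.
rewrite /limn_esup /limf_esup => /ereal_inf_lt [_ [V [N _ NV] <-]] h.
exists N => n Nn; rewrite -lte_fin; apply: le_lt_trans h.
by apply: ereal_sup_ubound; exists n => //; exact: NV.
Qed.

(* [g n.+1 = nu (step_index stay n)]: the index shift keeps [step_index] total at [0]. *)
Fixpoint step_index (stay : nat -> bool) (n : nat) : nat :=
  if n is n'.+1 then
    if stay n then step_index stay n' else (step_index stay n').+1
  else 1.

(** * Step sizes as values of [nu] along a counting index *)

Section StepSizes.
Context (R : realType) (nu g : nat -> R) (stay : nat -> bool).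
Hypothesis nu01 : forall n, (0 < n)%N -> 0 < nu n < 1.
Hypothesis nudec : forall n m, (0 < n)%N -> (n < m)%N -> nu m < nu n.
Hypothesis g1 : g 1 = nu 1.
Hypothesis gstay : forall n, (0 < n)%N -> stay n -> g n.+1 = g n.
Hypothesis gdrop : forall n, (0 < n)%N -> ~~ stay n ->
  let S := [set x : R | (0 < x < g n) /\ exists k, (0 < k)%N /\ x = nu k] in
  S (g n.+1) /\ forall y, S y -> y <= g n.+1.

Let K := step_index stay.

Lemma step_index_gt0 n : (0 < K n)%N.
Proof. by rewrite /K; elim: n => //= n IH; case: ifP. Qed.

Lemma step_index_le n : (K n <= n.+1)%N.
Proof. by rewrite /K; elim: n => //= n IH; case: ifP => // _; exact: leqW. Qed.

Lemma step_index_homo : {homo K : n m / (n <= m)%N}.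
Proof.
apply: homo_leq => // [x y z|n]; first exact: leq_trans.
by rewrite /K /=; case: ifP.
Qed.

Let nule n m : (0 < n)%N -> (n <= m)%N -> nu m <= nu n.
Proof.
by move=> n0; rewrite leq_eqVlt => /predU1P[->//|nm]; exact/ltW/nudec.
Qed.

(** As [nu] is strictly decreasing, its largest value below [nu (K n)] is the next one, so every
    drop advances the index by exactly one. *)
Lemma step_sizeE n : g n.+1 = nu (K n).
Proof.
elim: n => [|n IH]; first exact: g1.
rewrite /K /=; case: ifPn => [st|st]; first by rewrite gstay.
rewrite -/(K n); have Kn := step_index_gt0 n.
have [[/andP[gp]]] := gdrop (ltn0Sn n) st.
rewrite IH => glt [k [k0 gE]] gmax.
apply/eqP; rewrite eq_le gmax ?andbT.
  rewrite gE; apply: nule => //.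
  rewrite ltnNge; apply/negP => kK; move: glt; rewrite gE ltNge.
  by rewrite nule.
split; last by exists (K n).+1.
by rewrite nudec// andbT; have /andP[] := nu01 (ltn0Sn (K n)).
Qed.

Lemma step_size_gt0 n : (0 < n)%N -> 0 < g n <= nu 1.
Proof.
case: n => // n _; rewrite step_sizeE nule ?step_index_gt0// andbT.
by have /andP[] := nu01 (step_index_gt0 n).
Qed.

(** The index advances by at most one per step. Divergence of the sum of [nu] thus bounds all
    hitting times by deterministic ones. *)
Lemma step_size_ge n : (0 < n)%N -> nu n <= g n.
Proof.
by case: n => // n _; rewrite step_sizeE nule ?step_index_gt0// step_index_le.
Qed.

Lemma step_size_le n m : (0 < n <= m)%N -> g m <= g n.
Proof.
case: n => // n; case: m => // m nm.
by rewrite !step_sizeE nule ?step_index_gt0// step_index_homo.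
Qed.

Lemma step_index_unbounded : (forall n0, exists n, (n0 <= n)%N /\ ~~ stay n) ->
  forall k, exists n, (k <= K n)%N.
Proof.
move=> H; elim=> [|k [n kn]]; first by exists 0%N.
have [[|m] [nm st]] := H n.+1; first by rewrite ltn0 in nm.
exists m.+1; rewrite /K /= (negbTE st) ltnS; apply: (leq_trans kn).
exact: step_index_homo.
Qed.

Lemma step_index_cst n0 : (forall n, (n0 <= n)%N -> stay n) ->
  forall n, K (n0 + n) = K n0.
Proof.
move=> H; elim=> [|n IH]; first by rewrite addn0.
by rewrite addnS /K /= H ?IH// -addnS leq_addr.
Qed.

Lemma step_size_cvg0 : limn_esup (fun n => (nu n)%:E) = 0%E ->
  (forall n0, exists n, (n0 <= n)%N /\ ~~ stay n) ->
  g n @[n --> \oo] --> (0 : R).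
Proof.
move=> nu0 H; apply/cvgrPdist_lt => e e0.
have [N HN] := limn_esup0_lt nu0 e0.
have [n Nn] := step_index_unbounded H N.
exists n.+1 => // -[//|m] /= nm; rewrite sub0r normrN.
rewrite gtr0_norm; last by have /andP[] := step_size_gt0 (ltn0Sn m).
rewrite step_sizeE HN// (leq_trans Nn)//; exact: step_index_homo.
Qed.

End StepSizes.

(** * Euclidean norm, gradient and Borel sets of vectors *)

Lemma enorm_sq (R : realType) n (v : 'rV[R]_n) : enorm v ^+ 2 = \sum_i v ord0 i ^+ 2.
Proof. by rewrite sqr_sqrtr// sumr_ge0// => i _; exact: sqr_ge0. Qed.

Lemma enorm_ge0 (R : realType) n (v : 'rV[R]_n) : 0 <= enorm v.
Proof. exact: sqrtr_ge0. Qed.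

(** Along the [i]-th axis all other coordinates cancel, and for [h != 0] the difference quotient is
    exactly [2 * (theta_i - x_i) + h]. *)
Lemma grad1_sq_enorm (R : realType) n (l : 'rV[R]_n -> 'rV[R]_n -> R) theta x :
  (forall theta x, l theta x = enorm (theta - x) ^+ 2) ->
  grad1 l theta x = 2 *: (theta - x).
Proof.
move=> lE; apply/rowP => i; rewrite !mxE /derive.
apply: cvg_lim => //.
have : 2 * (theta ord0 i - x ord0 i) + h @[h --> (0 : R)^'] -->
    2 * (theta ord0 i - x ord0 i) + 0.
  by apply: cvgD; [exact: cvg_cst|exact: nbhs_dnbhs].
rewrite addr0; apply: cvg_trans; apply: near_eq_cvg.
near=> h.
have h0 : h != 0 by near: h; exact: nbhs_dnbhs_neq.
rewrite /= !lE !enorm_sq -sumrB (bigD1 i)//= big1 => [|j ji].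
  rewrite !mxE !eqxx addr0 /GRing.scale/=; by field.
by rewrite !mxE eqxx (negbTE ji) mulr0 add0r subrr.
Unshelve. all: by end_near.
Qed.

Lemma random_vector_coord (R : realType) d (T : measurableType d) n (Y : T -> 'rV[R]_n) i :
  random_vector Y -> measurable_fun setT (fun w => Y w ord0 i).
Proof.
move=> mY _ B mB; rewrite setTI.
apply: (mY ((fun v : 'rV[R]_n => v ord0 i) @^-1` B)).
by apply: sub_sigma_algebra; exists i, B.
Qed.

Lemma rv_sigma_coord (R : realType) (T : Type) n (Y : T -> 'rV[R]_n) i B :
  measurable B -> rv_sigma Y ((fun w => Y w ord0 i) @^-1` B).
Proof.
move=> mB; exists ((fun v : 'rV[R]_n => v ord0 i) @^-1` B) => //.
by apply: sub_sigma_algebra; exists i, B.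
Qed.

Lemma rv_sigmaT (R : realType) (T : Type) n (Y : T -> 'rV[R]_n) : rv_sigma Y setT.
Proof.
exists setT => //.
exact: (@measurableT _ (g_sigma_algebraType _)).
Qed.

Lemma rv_sigmaI (R : realType) (T : Type) n (Y : T -> 'rV[R]_n) : setI_closed (rv_sigma Y).
Proof.
move=> _ _ [B mB <-] [C mC <-]; exists (B `&` C) => //.
exact: (@measurableI _ (g_sigma_algebraType _)).
Qed.

Lemma rv_sigma_measurable (R : realType) d (T : measurableType d) n (Y : T -> 'rV[R]_n) :
  random_vector Y -> rv_sigma Y `<=` measurable.
Proof. by move=> mY _ [B mB <-]; exact: mY. Qed.

(** The ball is a sublevel set of a polynomial in the coordinates, and the coordinates are
    measurable for the sigma-algebra that defines [rV_borel]. *)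
Lemma rV_borel_enorm_ball (R : realType) n (x : 'rV[R]_n) (e : R) : 0 < e ->
  @rV_borel R n [set v | enorm (v - x) < e].
Proof.
move=> e0.
pose G : set (set 'rV[R]_n) := [set A | exists (i : 'I_n) (B : set R),
          measurable B /\ A = (fun v : 'rV[R]_n => v ord0 i) @^-1` B].
have mc i : measurable_fun [set: g_sigma_algebraType G]
    (fun v : g_sigma_algebraType G => (v : 'rV[R]_n) ord0 i).
  by move=> _ B mB; rewrite setTI; apply: sub_sigma_algebra; exists i, B.
have mf : measurable_fun [set: g_sigma_algebraType G]
    (fun v : g_sigma_algebraType G => \sum_i ((v : 'rV[R]_n) ord0 i - x ord0 i) ^+ 2).
  apply: measurable_sum => i; apply: measurable_funX.
  by apply: measurable_funB => //; exact: measurable_cst.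
have := measurable_fun_ltr mf (@measurable_cst _ _ (g_sigma_algebraType G) _ setT (e ^+ 2)).
move=> /(_ measurableT [set true] I); rewrite setTI.
congr (measurable _).
have E (v : 'rV[R]_n) : (enorm (v - x) < e) = (\sum_i (v ord0 i - x ord0 i) ^+ 2 < e ^+ 2).
  rewrite -[LHS](@ltr_pXn2r _ 2)// ?nnegrE ?enorm_ge0 ?ltW// enorm_sq.
  by congr (_ < _); apply: eq_bigr => i _; rewrite !mxE.
by apply/seteqP; split => v /=; rewrite E.
Qed.

Lemma enorm_coord (R : realType) n (v : 'rV[R]_n) i : `|v ord0 i| <= enorm v.
Proof.
rewrite -(@ler_pXn2r _ 2)// ?nnegrE ?enorm_ge0// real_normK ?num_real// enorm_sq.
by rewrite (bigD1 i)//= lerDl sumr_ge0// => j _; exact: sqr_ge0.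
Qed.

(** The integral of a nonnegative function is a supremum over the simple functions below it, hence
    monotone. In this form it applies directly to the distance evaluated at the random time
    [first_hit]. *)
Lemma le_ge0_integral (R : realType) d (T : measurableType d)
    (mu : {measure set T -> \bar R}) (f h : T -> \bar R) :
  (forall w, (0 <= f w)%E) -> (forall w, (f w <= h w)%E) ->
  (\int[mu]_w f w <= \int[mu]_w h w)%E.
Proof.
move=> f0 fh; rewrite !ge0_integralTE//; last first.
  by move=> w; apply: le_trans (fh w).
apply: le_ereal_sup => _ [s sf <-].
by exists s => // w; apply: le_trans (fh w); exact: sf.
Qed.

Lemma centered_sum (R : realType) d (T : measurableType d) (P : probability T R)
    (J : eqType) (s : seq J) (f : J -> T -> R) :
  (forall j, j \in s -> P.-integrable setT (EFin \o f j) /\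
     (\int[P]_w (f j w)%:E = 0)%E) ->
  P.-integrable setT (EFin \o (fun w => \sum_(j <- s) f j w)) /\
  (\int[P]_w (\sum_(j <- s) f j w)%:E = 0)%E.
Proof.
elim: s => [_|j s IH H].
  have E : (fun w => \sum_(j <- [::]) f j w) = cst 0 by apply/funext => w; rewrite big_nil.
  rewrite E; split; last by rewrite integral0_eq// => w _; rewrite big_nil.
  exact: finite_measure_integrable_cst.
have E : (fun w => \sum_(k <- j :: s) f k w) = (fun w => f j w + \sum_(k <- s) f k w).
  by apply/funext => w; rewrite big_cons.
have [i1 e1] := H j (mem_head _ _).
have [i2 e2] : P.-integrable setT (EFin \o (fun w => \sum_(j <- s) f j w)) /\
    (\int[P]_w (\sum_(j <- s) f j w)%:E = 0)%E.
  by apply: IH => k ks; apply: H; rewrite inE ks orbT.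
rewrite E; split.
  have -> : EFin \o (fun w => f j w + \sum_(k <- s) f k w) =
     (EFin \o f j) \+ (EFin \o (fun w => \sum_(k <- s) f k w)) by [].
  exact: integrableD.
under eq_integral do rewrite big_cons EFinD.
by rewrite integralD// e1 e2 adde0.
Qed.

(** * Linear rules for means *)

Section Means.
Context (R : realType) d (T : measurableType d) (P : probability T R).

Definition has_mean (f : T -> R) (m : R) : Prop :=
  P.-integrable setT (EFin \o f) /\ (\int[P]_w (f w)%:E = m%:E)%E.

Lemma has_mean_cst (c : R) : has_mean (cst c) c.
Proof.
split; first exact: finite_measure_integrable_cst.
have -> : (\int[P]_w (cst c w)%:E = \int[P]_w (cst c%:E) w)%E by [].
by rewrite integral_cst// [X in (_ * X)%E](@probability_setT _ _ _ P) mule1.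
Qed.

Lemma has_meanD f g m n : has_mean f m -> has_mean g n ->
  has_mean (fun w => f w + g w) (m + n).
Proof.
move=> [fi fm] [gi gn]; split.
  have -> : EFin \o (fun w => f w + g w) = ((EFin \o f) \+ (EFin \o g))%E by [].
  exact: integrableD.
by under eq_integral do rewrite EFinD; rewrite integralD// fm gn.
Qed.

Lemma has_meanZ k f m : has_mean f m -> has_mean (fun w => k * f w) (k * m).
Proof.
move=> [fi fm]; split; first exact: (@integrableZl _ _ _ P setT measurableT k (EFin \o f) fi).
by under eq_integral do rewrite EFinM; rewrite integralZl// fm.
Qed.

Lemma integrable_has_mean f : P.-integrable setT (EFin \o f) ->
  has_mean f (fine (\int[P]_w (f w)%:E)%E).
Proof. by move=> fi; split => //; rewrite fineK// integrable_fin_num. Qed.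

End Means.

(** * The samples *)

Section Samples.
Context (R : realType) (d : nat) (a b : R) (dT : measure_display)
  (T : measurableType dT) (P : probability T R).
Variables (X : int -> int -> T -> 'rV[R]_d) (Theta0 : T -> 'rV[R]_d) (M MM : nat).
Hypothesis HXrv : forall n m, random_vector (X n m).
Hypothesis HXrange : forall n m w (i : 'I_d), a <= X n m w ord0 i <= b.
Hypothesis HXind : mutually_independent P
             (fun nm : int * int => rv_sigma (X nm.1 nm.2)).
Hypothesis HXid : forall n m B, @rV_borel R d B ->
             P (X n m @^-1` B) = P (X 0 0 @^-1` B).
Hypothesis HTheta0rv : random_vector Theta0.
Hypothesis HXTheta0 : independent2 P
     (<<s \bigcup_(nm in [set: int * int]) rv_sigma (X nm.1 nm.2) >>)
     (rv_sigma Theta0).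

Let mu i := Rintegral P setT (fun w => X 1 1 w ord0 i).

Lemma sample_integrable n m i : P.-integrable setT (EFin \o (fun w => X n m w ord0 i)).
Proof.
apply: (@le_integrable _ _ _ P setT measurableT _ (EFin \o cst (`|a| + `|b|))).
- exact/measurable_EFinP/random_vector_coord.
- move=> w _ /=; rewrite lee_fin [leRHS]ger0_norm ?addr_ge0//.
  have /andP[] := HXrange n m w i; rewrite ler_norml => h1 h2.
  have := ler_norm b; have := ler_norm (- a); rewrite normrN => h3 h4.
  have := normr_ge0 a; have := normr_ge0 b => h5 h6.
  by apply/andP; split; lra.
- exact: finite_measure_integrable_cst.
Qed.

Lemma sample_mean n m i : (\int[P]_w (X n m w ord0 i)%:E = (mu i)%:E)%E.
Proof.
have H n' m' : (\int[P]_w (X n' m' w ord0 i)%:E =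
    \int[pushforward P (fun w => X 0 0 w ord0 i)]_y y%:E)%E.
  have mX := random_vector_coord i (HXrv n' m').
  transitivity (\int[pushforward P (fun w => X n' m' w ord0 i)]_y y%:E)%E.
    rewrite (integral_pushforward mX)//; last exact: sample_integrable.
  apply: eq_measure_integral => //; [exact: random_vector_coord|move=> mX0 A mA _].
  rewrite /pushforward.
  have mB : @rV_borel R d ((fun v : 'rV[R]_d => v ord0 i) @^-1` A).
    by apply: sub_sigma_algebra; exists i, A.
  exact: (HXid n' m' mB).
rewrite /mu /Rintegral H -(H 1 1) fineK//.
by apply: integrable_fin_num => //; exact: sample_integrable.
Qed.

Lemma mean_range i : a <= mu i <= b.
Proof.
have h (c : R) : (\int[P]_w c%:E = c%:E)%E.
  by rewrite integral_cst// [X in (_ * X)%E](@probability_setT _ _ _ P) mule1.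
rewrite -[a <= _]lee_fin -[_ <= b]lee_fin -(sample_mean 1 1 i) -(h a) -[X in _ && (_ <= X)%E](h b).
apply/andP; split; apply: le_integral => //;
  try exact: sample_integrable; try exact: finite_measure_integrable_cst;
  by move=> w _; rewrite lee_fin; have /andP[] := HXrange 1 1 w i.
Qed.

Lemma sample_centered n m i : (\int[P]_w (X n m w ord0 i - mu i)%:E = 0)%E.
Proof.
rewrite integralB_EFin//; last 2 first.
- exact: sample_integrable.
- exact: finite_measure_integrable_cst.
by rewrite sample_mean integral_cst// [X in (_ * X)%E](@probability_setT _ _ _ P) mule1 subee.
Qed.

(** Second indices used at one time: training samples at [1, ..., M], validation samples at
    [-1, ..., -MM]. *)
Definition sample_slots : seq int :=
  [seq m%:Z | m <- iota 1 M] ++ [seq - m%:Z | m <- iota 1 MM].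

Lemma sample_slots_uniq : uniq sample_slots.
Proof.
rewrite cat_uniq !map_inj_uniq ?iota_uniq/= ?andbT; last 2 first.
- by move=> m m' /oppr_inj [].
- by move=> m m' [].
apply/hasPn => z /mapP[m]; rewrite mem_iota => mMM -> {z}; apply/negP => /mapP[m'].
by rewrite mem_iota; lia.
Qed.

Definition past_indices n : seq (int * int) :=
  [seq (k%:Z, m) | k <- iota 1 n, m <- sample_slots].

Lemma past_indices_uniq n : uniq (past_indices n).
Proof.
apply: allpairs_uniq; [exact: iota_uniq|exact: sample_slots_uniq|].
by move=> [k m] [k' m'] _ _ /= [-> ->].
Qed.

(** [g_sigma_algebraType (past n)] serves as the filtration at time [n]: it is generated by [Theta0]
    and the samples of the times [1, ..., n]. *)
Definition past n := past_cylinder (fun nm : int * int => rv_sigma (X nm.1 nm.2))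
  (rv_sigma Theta0) (past_indices n).

Lemma past_sample k n m i : (0 < k <= n)%N -> m \in sample_slots ->
  measurable_fun [set: g_sigma_algebraType (past n)] (fun w => X k%:Z m w ord0 i).
Proof.
move=> kn mm _ B mB; rewrite setTI; apply: sub_sigma_algebra.
apply: (@past_cylinder_proj _ _ _ _ _ _ _ _ (k%:Z, m)) => /=.
- by move=> ?; exact: rv_sigmaT.
- exact: rv_sigmaT.
- by apply: allpairs_f => //; rewrite mem_iota; lia.
- exact: rv_sigma_coord.
Qed.

(** This is the martingale difference property: a fresh centered sample is independent of the past,
    so a past-measurable integrable factor keeps its mean zero. *)
Lemma centered_increment n m i (H : T -> R) : m \in sample_slots ->
  measurable_fun [set: g_sigma_algebraType (past n)] H ->
  P.-integrable setT (EFin \o H) ->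
  P.-integrable setT (EFin \o (fun w => H w * (X n.+1%:Z m w ord0 i - mu i))) /\
  (\int[P]_w (H w * (X n.+1%:Z m w ord0 i - mu i))%:E = 0)%E.
Proof.
move=> mm mH iH.
have mF (nm : int * int) : rv_sigma (X nm.1 nm.2) `<=` @measurable _ T.
  exact: rv_sigma_measurable.
have mF0 : rv_sigma Theta0 `<=` @measurable _ T by exact: rv_sigma_measurable.
have mpast : past n `<=` @measurable _ T by exact: past_cylinder_measurable.
have mY : measurable_fun setT (fun w => X n.+1%:Z m w ord0 i - mu i).
  by apply: measurable_funB; [exact: random_vector_coord|exact: measurable_cst].
(* The identity, seen as a map into [T] with the sigma-algebra of the past, represents the past as
   one random element. *)
apply: (@integral_mul_indep_centered R _ _ T (g_sigma_algebraType (past n)) P id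
  _ H (b - a)) => //.
- move=> _ B mB; rewrite setTI.
  by move: mB; apply: smallest_sub => //; exact: sigma_algebra_measurable.
- move=> w; have /andP[h1 h2] := HXrange n.+1%:Z m w i; have /andP[h3 h4] := mean_range i.
  by rewrite ler_norml; apply/andP; split; lra.
- exact: sample_centered.
- move=> A B mA mB.
  apply: (@past_cylinder_indep _ _ _ _ _ _ _ (past_indices n)
    _ _ _ _ _ _ (n.+1%:Z, m) _ _ HXind HXTheta0) => //.
  + by move=> nm; exact: rv_sigmaT.
  + exact: rv_sigmaT.
  + by move=> nm; exact: rv_sigmaI.
  + exact: rv_sigmaI.
  + exact: past_indices_uniq.
  + apply/negP => /allpairsP[[k m'] [/= + _ [kn _]]].
    by rewrite mem_iota; lia.
  + have mB' : measurable ((fun x : R => x - mu i) @^-1` B).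
      rewrite -[X in measurable X]setTI.
      by apply: measurable_funB => //; exact: measurable_cst.
    exact: (@rv_sigma_coord _ _ _ _ i _ mB').
Qed.

End Samples.

(** * The descent scheme *)

Section Descent.
Context (R : realType) (d : nat) (a b : R) (dT : measure_display)
  (T : measurableType dT) (P : probability T R).
Variables (X : int -> int -> T -> 'rV[R]_d)
  (l : 'rV[R]_d -> 'rV[R]_d -> R) (M MM : nat)
  (Theta : nat -> T -> 'rV[R]_d) (gamma : nat -> T -> R) (nu : nat -> R).
Hypothesis HXrv : forall n m, random_vector (X n m).
Hypothesis HXrange : forall n m w (i : 'I_d), a <= X n m w ord0 i <= b.
Hypothesis HXind : mutually_independent P
             (fun nm : int * int => rv_sigma (X nm.1 nm.2)).
Hypothesis HXid : forall n m B, @rV_borel R d B ->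
             P (X n m @^-1` B) = P (X 0 0 @^-1` B).
Hypothesis Hl : forall theta x, l theta x = enorm (theta - x) ^+ 2.
Hypotheses (HM : (0 < M)%N) (HMM : (0 < MM)%N).
Hypothesis HThetarv : forall n, random_vector (Theta n).
Hypothesis Hgammarv : forall n, (0 < n)%N -> measurable_fun setT (gamma n).
Hypothesis HThetarec : forall n w, (0 < n)%N ->
     Theta n w = Theta n.-1 w - (gamma n w / M%:R) *:
       \sum_(1 <= m < M.+1) grad1 l (Theta n.-1 w) (X n%:Z m%:Z w).
Hypothesis HXTheta0 : independent2 P
     (<<s \bigcup_(nm in [set: int * int]) rv_sigma (X nm.1 nm.2) >>)
     (rv_sigma (Theta 0%N)).
Hypothesis HTheta0 : (\int[P]_w ((enorm (Theta 0%N w)) ^+ 2)%:E < +oo)%E.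
Hypothesis Hnu01 : forall n, (0 < n)%N -> 0 < nu n < 1.
Hypothesis Hnudec : forall n m, (0 < n)%N -> (n < m)%N -> nu m < nu n.
Hypothesis Hgamma1 : forall w, gamma 1%N w = nu 1%N.

Definition loss_decreases w n : bool :=
  \sum_(1 <= m < MM.+1) l (Theta n w) (X n%:Z (- m%:Z) w) <=
  \sum_(1 <= m < MM.+1) l (Theta n.-1 w) (X n%:Z (- m%:Z) w).

Hypothesis Hgammastay : forall n w, (0 < n)%N -> loss_decreases w n ->
  gamma n.+1 w = gamma n w.
Hypothesis Hgammadrop : forall n w, (0 < n)%N -> ~~ loss_decreases w n ->
     let S := [set x : R | (0 < x < gamma n w) /\
                           exists k, (0 < k)%N /\ x = nu k] in
     S (gamma n.+1 w) /\ forall y, S y -> y <= gamma n.+1 w.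

Let mu i := Rintegral P setT (fun w => X 1 1 w ord0 i).
Let batch n w i := (\sum_(m < M) X n%:Z m.+1%:Z w ord0 i) / M%:R.
Let past := past X (Theta 0%N) M MM.

Lemma gammaE n w : gamma n.+1 w = nu (step_index (loss_decreases w) n).
Proof.
apply: (@step_sizeE _ nu (fun n => gamma n w)) => // k k0.
- exact: Hgammastay.
- exact: Hgammadrop.
Qed.

Lemma gamma01 n w : 0 < gamma n.+1 w < 1.
Proof. by rewrite gammaE; apply/Hnu01/step_index_gt0. Qed.

Lemma Theta_coordS n w i : Theta n.+1 w ord0 i =
  (1 - 2 * gamma n.+1 w) * Theta n w ord0 i + 2 * gamma n.+1 w * batch n.+1 w i.
Proof.
rewrite HThetarec//= !mxE summxE big_add1 big_mkord.
have -> : \sum_(m < M) grad1 l (Theta n w) (X n.+1%:Z m.+1%:Z w) ord0 i =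
    2 * (M%:R * Theta n w ord0 i - \sum_(m < M) X n.+1%:Z m.+1%:Z w ord0 i).
  have -> : M%:R * Theta n w ord0 i = \sum_(m < M) Theta n w ord0 i.
    by rewrite sumr_const card_ord mulr_natl.
  rewrite -sumrB mulr_sumr.
  by apply: eq_bigr => m _; rewrite (grad1_sq_enorm _ _ Hl) !mxE.
rewrite /batch; field.
by rewrite pnatr_eq0 -lt0n.
Qed.

Lemma batch_range n w i : a <= batch n w i <= b.
Proof.
have M0 : 0 < M%:R :> R by rewrite ltr0n.
have E (x : R) : x * M%:R = \sum_(m < M) x by rewrite sumr_const card_ord mulr_natr.
rewrite /batch ler_pdivlMr// ler_pdivrMr// !E.
by apply/andP; split; apply: ler_sum => m _; have /andP[] := HXrange n%:Z m.+1%:Z w i.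
Qed.

(** Joint induction: the index at time [k] fixes [gamma k.+1], which with the training samples gives
    [Theta k.+1], and the validation losses then give the next index. Passing through the index is
    convenient because every function on [nat] is measurable. *)
Lemma adapted n k : (k <= n)%N ->
  (forall i, measurable_fun [set: g_sigma_algebraType (past n)]
     (fun w => Theta k w ord0 i)) /\
  measurable_fun [set: g_sigma_algebraType (past n)]
     (fun w => step_index (loss_decreases w) k).
Proof.
pose T' := g_sigma_algebraType (past n).
have mnat (f : nat -> R) : measurable_fun setT f by [].
have mX j m i : (0 < j <= n)%N -> m \in sample_slots M MM ->
  measurable_fun [set: T'] (fun w => X j%:Z m w ord0 i) by exact: past_sample.
elim: k => [_|k IH kn].
  split=> [i|]; last exact: measurable_cst.
  move=> _ B mB; rewrite setTI; apply: sub_sigma_algebra.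
  apply: past_cylinder_base; last exact: rv_sigma_coord.
  by move=> ?; exact: rv_sigmaT.
have [mT mK] := IH (ltnW kn).
have mg : measurable_fun [set: T'] (fun w => gamma k.+1 w).
  have -> : (fun w => gamma k.+1 w) = nu \o (fun w => step_index (loss_decreases w) k).
    by apply/funext => w; exact: gammaE.
  by apply: measurableT_comp => //; exact: mnat.
have mTS i : measurable_fun [set: T'] (fun w => Theta k.+1 w ord0 i).
  have -> : (fun w => Theta k.+1 w ord0 i) = (fun w =>
    (1 - 2 * gamma k.+1 w) * Theta k w ord0 i + 2 * gamma k.+1 w * batch k.+1 w i).
    by apply/funext => w; exact: Theta_coordS.
  apply: measurable_funD; apply: measurable_funM => //.
  - apply: measurable_funB; first exact: measurable_cst.
    by apply: measurable_funM => //; exact: measurable_cst.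
  - by apply: measurable_funM => //; exact: measurable_cst.
  - apply: measurable_funM; last exact: measurable_cst.
    apply: measurable_sum => m; apply: mX => //.
    rewrite mem_cat; apply/orP; left; apply: map_f.
    by rewrite mem_iota add1n !ltnS leq0n ltn_ord.
split => //=.
apply: measurable_fun_ifT => //; last first.
  have -> : (fun w => (step_index (loss_decreases w) k).+1) =
    S \o (fun w => step_index (loss_decreases w) k) by [].
  by apply: measurableT_comp.
have mloss j : (forall i, measurable_fun [set: T'] (fun w => Theta j w ord0 i)) ->
   measurable_fun [set: T'] (fun w =>
     \sum_(1 <= m < MM.+1) l (Theta j w) (X k.+1%:Z (- m%:Z) w)).
  move=> mTj; under eq_fun do rewrite big_add1 big_mkord.
  apply: measurable_sum => m.
  under eq_fun do rewrite Hl enorm_sq.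
  apply: measurable_sum => i.
  under eq_fun do rewrite !mxE.
  apply: measurable_funX; apply: measurable_funB => //.
  apply: mX => //; rewrite mem_cat; apply/orP; right; apply/mapP.
  by exists m.+1 => //; rewrite mem_iota add1n !ltnS leq0n ltn_ord.
by apply: measurable_fun_ler; exact: mloss.
Qed.

(** The step size is predictable: [gamma n.+1] is already determined at time [n]. *)
Lemma adapted_gamma n k : (0 < k <= n.+1)%N ->
  measurable_fun [set: g_sigma_algebraType (past n)] (gamma k).
Proof.
case: k => // k kn; have [_ mK] := @adapted n k kn.
have -> : gamma k.+1 = nu \o (fun w => step_index (loss_decreases w) k).
  by apply/funext => w; exact: gammaE.
by apply: measurableT_comp.
Qed.

Let S n w := \sum_(1 <= k < n.+1) gamma k w.

Lemma adapted_clock n k : (k <= n.+1)%N ->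
  measurable_fun [set: g_sigma_algebraType (past n)] (S k).
Proof.
move=> kn; rewrite /S; under eq_fun do rewrite big_add1 big_mkord.
apply: measurable_sum => j; apply: adapted_gamma.
by rewrite /= (leq_trans _ kn).
Qed.

Lemma past_measurable n (f : T -> R) :
  measurable_fun [set: g_sigma_algebraType (past n)] f -> measurable_fun [set: T] f.
Proof.
move=> mf _ B mB; have := mf measurableT B mB.
apply: smallest_sub => //; first exact: sigma_algebra_measurable.
by apply: past_cylinder_measurable => [nm|]; exact: rv_sigma_measurable.
Qed.

Lemma clock_le n w : S n w <= n%:R.
Proof.
have -> : n%:R = \sum_(m < n) 1 :> R by rewrite sumr_const card_ord.
rewrite /S big_add1 big_mkord.
by apply: ler_sum => k _; have /andP[_ /ltW] := gamma01 k w.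
Qed.

Lemma integrable_bounded_mul (f g : T -> R) (C : R) :
  measurable_fun setT f -> (forall w, `|f w| <= C) ->
  P.-integrable setT (EFin \o g) -> P.-integrable setT (EFin \o (fun w => f w * g w)).
Proof.
move=> mf fC ig; apply: (@integrableMr _ _ _ P setT measurableT f (EFin \o g)) => //.
exists `|C|; split; first exact: num_real.
move=> x xC w _ /=; apply: le_trans (fC w) _; apply: le_trans (ltW xC); exact: ler_norm.
Qed.

Lemma integrable_sq_Theta0 : P.-integrable setT (EFin \o (fun w => enorm (Theta 0%N w) ^+ 2)).
Proof.
apply/integrableP; split.
  apply/measurable_EFinP; under eq_fun do rewrite enorm_sq.
  by apply: measurable_sum => i; apply: measurable_funX; exact: random_vector_coord.
by under eq_integral => w _ do rewrite /= ger0_norm ?sqr_ge0//.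
Qed.

Lemma integrable_Theta n i : P.-integrable setT (EFin \o (fun w => Theta n w ord0 i)).
Proof.
elim: n => [|n IH].
  apply: (@le_integrable _ _ _ P setT measurableT _
    (EFin \o (fun w => 1 + enorm (Theta 0%N w) ^+ 2))).
  - exact/measurable_EFinP/random_vector_coord.
  - move=> w _ /=; rewrite lee_fin [leRHS]ger0_norm ?addr_ge0 ?sqr_ge0//.
    have := enorm_coord (Theta 0%N w) i; set x := `|_|; set y := enorm _ => xy.
    apply: (le_trans xy); have := sqr_ge0 (y - 1); nra.
  - have -> : EFin \o (fun w => 1 + enorm (Theta 0%N w) ^+ 2) =
      (EFin \o cst 1) \+ (EFin \o (fun w => enorm (Theta 0%N w) ^+ 2)) by [].
    apply: integrableD => //; first exact: finite_measure_integrable_cst.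
    exact: integrable_sq_Theta0.
have -> : EFin \o (fun w => Theta n.+1 w ord0 i) =
  (EFin \o (fun w => (1 - 2 * gamma n.+1 w) * Theta n w ord0 i)) \+
  (EFin \o (fun w => 2 * gamma n.+1 w * batch n.+1 w i)).
  by apply/funext => w /=; rewrite Theta_coordS EFinD.
have mg := Hgammarv (ltn0Sn n).
apply: integrableD => //.
- apply: (@integrable_bounded_mul _ _ 1) => //.
    apply: measurable_funB; first exact: measurable_cst.
    by apply: measurable_funM => //; exact: measurable_cst.
  move=> w; have /andP[h1 h2] := gamma01 n w.
  by rewrite ler_norml; apply/andP; split; lra.
- apply: (@integrable_bounded_mul _ _ 2) => //.
  + by apply: measurable_funM => //; exact: measurable_cst.
  + move=> w; have /andP[h1 h2] := gamma01 n w.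
    by rewrite ler_norml; apply/andP; split; lra.
  + rewrite /batch; under eq_fun => w do rewrite mulrC.
    apply: (@integrable_bounded_mul _ _ M%:R^-1); first exact: measurable_cst.
      by move=> w; rewrite ger0_norm.
    have -> : EFin \o (fun w => \sum_(m < M) X n.+1 m.+1%:Z w ord0 i) =
      (fun w => \sum_(m < M) (X n.+1 m.+1%:Z w ord0 i)%:E)%E.
      by apply/funext => w /=; rewrite sumEFin.
    apply: integrable_sum => // m _; exact: sample_integrable.
Qed.

Let D n w i := Theta n w ord0 i - mu i.
Let xi n w i := batch n w i - mu i.

Lemma integrable_deviation n i : P.-integrable setT (EFin \o (fun w => D n w i)).
Proof.
have -> : EFin \o (fun w => D n w i) =
  ((EFin \o (fun w => Theta n w ord0 i)) \- (EFin \o cst (mu i)))%E by [].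
apply: integrableB => //; first exact: integrable_Theta.
exact: finite_measure_integrable_cst.
Qed.

(** Each summand is a bounded predictable weight times the integrable [D n], times a combination of
    fresh centered samples. *)
Lemma martingale_centered (c t : R) L : 0 <= c ->
  let F w := \sum_(1 <= k < L.+1) \sum_i
    ((S k.-1 w < t)%R%:R * (expR (c * S k w) * (4 * gamma k w * (1 - 2 * gamma k w)))
       * D k.-1 w i) * xi k w i in
  P.-integrable setT (EFin \o F) /\ (\int[P]_w (F w)%:E = 0)%E.
Proof.
move=> c0 F; apply: centered_sum => k.
rewrite mem_index_iota; case: k => // n _ /=.
apply: centered_sum => i _.
(* The weight includes [1 / M], so that the averaged noise becomes a plain sum of [M] centered
   samples. *)
pose q w := (S n w < t)%R%:R *
  (expR (c * S n.+1 w) * (4 * gamma n.+1 w * (1 - 2 * gamma n.+1 w))) / M%:R.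
have mq : measurable_fun [set: g_sigma_algebraType (past n)] q.
  have mg := @adapted_gamma n n.+1 (leqnn _).
  apply: measurable_funM; last exact: measurable_cst.
  apply: measurable_funM.
    have -> : (fun w => (S n w < t)%R%:R) = (fun w => if (S n w < t)%R then 1 else 0 : R).
      by apply/funext => w; case: ifP.
    apply: measurable_fun_ifT; try exact: measurable_cst.
    by apply: measurable_fun_ltr; [exact: adapted_clock|exact: measurable_cst].
  apply: measurable_funM.
    apply: measurableT_comp; first exact: measurable_expR.
    by apply: measurable_funM; [exact: measurable_cst|exact: adapted_clock].
  apply: measurable_funM; first by apply: measurable_funM => //; exact: measurable_cst.
  apply: measurable_funB; first exact: measurable_cst.
  by apply: measurable_funM => //; exact: measurable_cst.
have qC w : `|q w| <= expR (c * n.+1%:R) * 4.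
  have /andP[g0 g1] := gamma01 n w.
  rewrite /q normrM -[leRHS]mulr1 ler_pM ?normr_ge0//; last first.
    by rewrite ger0_norm ?invr_ge0// invf_le1 ?ltr0n// ler1n.
  rewrite normrM -[leRHS]mul1r ler_pM ?normr_ge0//.
    by case: (_ < _)%R; rewrite ?normr1 ?normr0.
  rewrite normrM ler_pM ?normr_ge0//.
    by rewrite ger0_norm ?expR_ge0// ler_expR ler_wpM2l// clock_le.
  by rewrite ler_norml; apply/andP; split; nra.
pose H w := q w * D n w i.
have mH : measurable_fun [set: g_sigma_algebraType (past n)] H.
  apply: measurable_funM => //; apply: measurable_funB; last exact: measurable_cst.
  by have [] := @adapted n n (leqnn _).
have iH : P.-integrable setT (EFin \o H).
  apply: (@integrable_bounded_mul _ _ _ _ qC); first exact: past_measurable mq.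
  exact: integrable_deviation.
pose f w := ((S n w < t)%R%:R *
     (expR (c * S n.+1 w) * (4 * gamma n.+1 w * (1 - 2 * gamma n.+1 w)))
       * D n w i) * xi n.+1 w i.
change (P.-integrable setT (EFin \o f) /\ (\int[P]_w (f w)%:E = 0)%E).
have -> : f = (fun w => \sum_(m < M) H w * (X n.+1%:Z m.+1%:Z w ord0 i - mu i)).
  apply/funext => w; rewrite -mulr_sumr sumrB sumr_const card_ord /f /H /q /xi /batch -mulr_natr.
  by field; rewrite pnatr_eq0 -lt0n.
apply: centered_sum => m _.
apply: (centered_increment (M := M) (MM := MM) HXrv HXrange HXind HXid (HThetarv 0) HXTheta0) => //.
rewrite mem_cat; apply/orP; left; apply/mapP; exists m.+1 => //.
by rewrite mem_iota add1n !ltnS leq0n ltn_ord.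
Qed.

(** * Almost sure convergence of the step sizes to zero *)

Hypothesis hd : (0 < d)%N.
Hypothesis hab : a < b.
Hypothesis Hsupp : forall x : 'rV[R]_d, (forall i, a <= x ord0 i <= b) ->
             forall eps : R, 0 < eps < 1 ->
             (0 < P [set w | (enorm (X 0%R 0%R w - x) < eps)%R])%E.
Hypothesis Hnulimsup : limn_esup (fun n => (nu n)%:E) = 0%E.

Definition sample_near (x : 'rV[R]_d) (eps : R) (nm : int * int) : set T :=
  [set w | enorm (X nm.1 nm.2 w - x) < eps].

Lemma sample_near_sigma x eps nm : 0 < eps ->
  rv_sigma (X nm.1 nm.2) (sample_near x eps nm).
Proof.
by move=> e0; exists [set v | enorm (v - x) < eps] => //; exact: rV_borel_enorm_ball.
Qed.

(* Block k consists of the times k (r + 1) + 1, ..., (k + 1) (r + 1); only the training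
   samples (positive second index) of its last time are steered to (b, ..., b). *)
Definition target r (nm : int * int) : 'rV[R]_d :=
  \row_(i < d) (if (0 < nm.2) && (`|nm.1|%N.-1 %% r.+1 == r)%N then b else a).

Definition block r k : seq (int * int) :=
  [seq (n%:Z, m) | n <- iota (k * r.+1).+1 r.+1, m <- sample_slots M MM].

Lemma block_uniq r k : uniq (block r k).
Proof.
apply: allpairs_uniq; [exact: iota_uniq|exact: sample_slots_uniq|].
by move=> [n m] [n' m'] _ _ /= [-> ->].
Qed.

(** The block number of a time [n] is recovered as [n.-1 %/ r.+1]. *)
Lemma block_disjoint r k k' nm : nm \in block r k -> nm \in block r k' -> k = k'.
Proof.
move=> /allpairsP[[n m] [h _ ->]] /allpairsP[[n' m'] [h' _ [nn _]]].
move: h h'; rewrite -nn !mem_iota /= => h h'.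
have E j : ((j * r.+1).+1 <= n < (j * r.+1).+1 + r.+1)%N -> (n.-1 %/ r.+1 = j)%N.
  case: n {h h' nn} => // n /andP[h1 h2] /=.
  have -> : n = (j * r.+1 + (n - j * r.+1))%N by rewrite subnKC.
  rewrite divnMDl// divn_small ?addn0//.
  by rewrite ltn_subLR.
by rewrite -(E k h) (E k' h').
Qed.

(** Only two target points occur, so each index succeeds with probability at least the smaller of
    two positive numbers. All blocks have the same size [s], which gives the uniform lower bound
    [q ^+ s]. *)
Lemma blocks_ae (eps : R) r : 0 < eps < 1 -> \forall w \ae P, forall n, exists k,
  (n <= k)%N /\ forall nm, nm \in block r k -> sample_near (target r nm) eps nm w.
Proof.
move=> e01; have /andP[e0 _] := e01.
pose A nm := sample_near (target r nm) eps nm.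
have FA nm : rv_sigma (X nm.1 nm.2) (A nm) by exact: sample_near_sigma.
have mA nm : measurable (A nm) by apply: rv_sigma_measurable (FA nm).
pose lo : 'rV[R]_d := \row_(i < d) a; pose hi : 'rV[R]_d := \row_(i < d) b.
pose p x := fine (P (sample_near x eps (0, 0))).
have mN x nm : measurable (sample_near x eps nm).
  exact: (rv_sigma_measurable (HXrv nm.1 nm.2) (sample_near_sigma x nm e0)).
have p0 (x : 'rV[R]_d) : (forall i, a <= x ord0 i <= b) -> 0 < p x.
  by move=> xab; rewrite -lte_fin fineK ?fin_num_measure//; exact: Hsupp.
have lo0 : 0 < p lo by apply: p0 => i; rewrite mxE lexx ltW.
have hi0 : 0 < p hi by apply: p0 => i; rewrite mxE lexx ltW.
pose q := Num.min (p lo) (p hi).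
have q0 : 0 < q by rewrite lt_min lo0.
have qA nm : (q%:E <= P (A nm))%E.
  have -> : P (A nm) = (p (target r nm))%:E.
    rewrite fineK ?fin_num_measure//.
    exact: (HXid nm.1 nm.2 (rV_borel_enorm_ball (target r nm) e0)).
  rewrite lee_fin ge_min /target; case: ifP => _; rewrite lexx ?orbT//.
have qJ J : ((q ^+ size J)%:E <= \prod_(nm <- J) P (A nm))%E.
  elim: J => [|nm J IH]; first by rewrite big_nil expr0.
  rewrite big_cons exprS EFinM; apply: lee_pmul => //; rewrite lee_fin ?exprn_ge0//; exact: ltW.
pose s := size (block r 0).
apply: (@block_borel_cantelli _ _ _ P _ (fun nm => rv_sigma (X nm.1 nm.2)) A _ FA HXind
  (block r) (block_uniq r) (@block_disjoint r) (q ^+ s)).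
- by move=> nm; exact: rv_sigma_measurable.
- by rewrite exprn_gt0.
- move=> k; rewrite -lee_fin fineK; last first.
    rewrite fin_num_measure// bigcap_seq.
    by apply: bigsetI_measurable => nm _; exact: mA.
  have -> : s = size (block r k) by rewrite /s !size_allpairs !size_iota.
  by rewrite HXind ?block_uniq.
Qed.

Lemma batch_near n w i (c e : R) : (forall m, (m < M)%N -> `|X n%:Z m.+1%:Z w ord0 i - c| <= e) ->
  `|batch n w i - c| <= e.
Proof.
move=> H; have M0 : 0 < M%:R :> R by rewrite ltr0n.
have -> : batch n w i - c = (\sum_(m < M) (X n%:Z m.+1%:Z w ord0 i - c)) / M%:R.
  rewrite sumrB sumr_const card_ord -mulr_natr /batch; field; exact: lt0r_neq0.
rewrite normrM [`|_^-1|]gtr0_norm ?invr_gt0// ler_pdivrMr//.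
apply: (le_trans (ler_norm_sum _ _ _)).
have -> : e * M%:R = \sum_(m < M) e by rewrite sumr_const card_ord mulr_natr.
by apply: ler_sum => m _; exact: H.
Qed.

Lemma drops_ae : \forall w \ae P, forall n0, exists n, (n0 <= n)%N /\ ~~ loss_decreases w n.
Proof.
pose good (k0 R0 : nat) w := exists (eps : R) (r : nat),
  (forall (u x : nat -> R) (y : R),
    `|u 0 - a| <= R0%:R ->
    (forall k, (k <= r)%N -> u k.+1 = (1 - 2 * nu k0.+1) * u k + 2 * nu k0.+1 * x k) ->
    (forall k, (k < r)%N -> `|x k - a| <= eps) ->
    `|x r - b| <= eps -> `|y - a| <= eps ->
    (u r - y) ^+ 2 < (u r.+1 - y) ^+ 2) /\
  forall n, exists k, (n <= k)%N /\
    forall nm, nm \in block r k -> sample_near (target r nm) eps nm w.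
(* The eventual step size and the bound on the path depend on [w]. Indexing both by natural numbers
   leaves countably many null sets to discard before [w] is fixed. *)
have : \forall w \ae P, forall k0 R0, good k0 R0 w.
  apply: ae_foralln => k0; apply: ae_foralln => R0.
  have [eps e01 /(_ R0%:R)[r Hr]] := constant_step_increase (Hnu01 (ltn0Sn k0)) hab.
  have := blocks_ae r e01; apply: filterS => w Hw.
  by exists eps, r.
apply: filterS => w Hgood n0; apply: contrapT => /forallNP Hn.
have st n : (n0 <= n)%N -> loss_decreases w n.
  by move=> nn; apply: contrapT => /negP h; apply: (Hn n).
pose k0 := (step_index (loss_decreases w) n0).-1.
have gE j : (n0 <= j)%N -> gamma j.+1 w = nu k0.+1.
  move=> nj; rewrite gammaE -(subnKC nj) step_index_cst//.
  by rewrite /k0 prednK// step_index_gt0.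
set G := nu k0.+1 in gE.
have /andP[G0 G1] : 0 < G < 1 by exact: Hnu01.
(* With a constant step this distance to the corner satisfies a contracting recursion, so the path
   is bounded from [n0] on, and the start of any later block lies within [R0]. *)
pose u n := \sum_i `|Theta (n0 + n)%N w ord0 i - a|.
have uE n : u n.+1 <= `|1 - 2 * G| * u n + 2 * G * (b - a) * d%:R.
  have -> : 2 * G * (b - a) * d%:R = \sum_(i < d) 2 * G * (b - a).
    by rewrite sumr_const card_ord mulr_natr.
  rewrite /u mulr_sumr -big_split /=; apply: ler_sum => i _.
  rewrite addnS Theta_coordS gE ?leq_addr//.
  have -> : (1 - 2 * G) * Theta (n0 + n)%N w ord0 i + 2 * G * batch (n0 + n).+1 w i - a
    = (1 - 2 * G) * (Theta (n0 + n)%N w ord0 i - a) + 2 * G * (batch (n0 + n).+1 w i - a) by ring.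
  apply: (le_trans (ler_normD _ _)); rewrite !normrM lerD2l.
  rewrite [`|2|]ger0_norm// [`|G|]gtr0_norm// ler_pM2l ?mulr_gt0//.
  have /andP[h1 h2] := batch_range (n0 + n).+1 w i.
  by rewrite ger0_norm ?subr_ge0// lerD2r.
have q01 : 0 <= `|1 - 2 * G| < 1.
  by rewrite normr_ge0 ltr_norml; apply/andP; split; lra.
have ub := geometric_bounded q01 uE.
set Bd := Num.max _ _ in ub.
pose R0 := Num.bound `|Bd|.
have BdR : Bd <= R0%:R.
  by apply: ltW; apply: le_lt_trans (ler_norm _) _; rewrite /R0; exact: archi_boundP.
have [eps [r [Hr Hblocks]]] := Hgood k0 R0.
have [k [n0k Hk]] := Hblocks n0.
pose N := (k * r.+1)%N.
have n0N : (n0 <= N)%N by rewrite (leq_trans n0k)// leq_pmulr.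
have near_coord j m i : (j <= r)%N -> m \in sample_slots M MM ->
    `|X (N + j).+1%:Z m w ord0 i - (if (0 < m) && (j == r) then b else a)| <= eps.
  move=> jr mm.
  have : ((N + j).+1%:Z, m) \in block r k.
    by apply: allpairs_f => //; rewrite mem_iota; apply/andP; split; lia.
  move=> /Hk; rewrite /sample_near/= => /ltW; apply: le_trans.
  apply: le_trans (enorm_coord _ i).
  by rewrite !mxE /= /N modnMDl modn_small.
have train m : (m < M)%N -> m.+1%:Z \in sample_slots M MM.
  move=> mM; rewrite mem_cat; apply/orP; left; apply/mapP; exists m.+1 => //.
  by rewrite mem_iota add1n !ltnS leq0n mM.
have valid m : (m < MM)%N -> - m.+1%:Z \in sample_slots M MM.
  move=> mM; rewrite mem_cat; apply/orP; right; apply/mapP; exists m.+1 => //.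
  by rewrite mem_iota add1n !ltnS leq0n mM.
have incr m i : (m < MM)%N ->
    (Theta (N + r)%N w ord0 i - X (N + r).+1%:Z (- m.+1%:Z) w ord0 i) ^+ 2 <
    (Theta (N + r).+1 w ord0 i - X (N + r).+1%:Z (- m.+1%:Z) w ord0 i) ^+ 2.
  move=> mM.
  (* The batch of time [N + j + 1] moves [Theta] from time [N + j] to [N + j + 1], so the jump [x r]
     is the last batch of the block. *)
  have := Hr (fun j => Theta (N + j)%N w ord0 i) (fun j => batch (N + j).+1 w i)
    (X (N + r).+1%:Z (- m.+1%:Z) w ord0 i).
  rewrite addnS; apply.
  - rewrite addn0 -(subnKC n0N).
    apply: (le_trans _ (le_trans (ub (N - n0)%N) BdR)).
    by rewrite /u (bigD1 i)//= lerDl sumr_ge0.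
  - by move=> j _; rewrite addnS Theta_coordS gE// (leq_trans n0N)// leq_addr.
  - move=> j jr; apply: batch_near => m' m'M.
    have := near_coord j _ i (ltnW jr) (train m' m'M).
    by rewrite (ltn_eqF jr) andbF.
  - apply: batch_near => m' m'M.
    by have := near_coord r _ i (leqnn r) (train m' m'M); rewrite eqxx.
  - by have := near_coord r _ i (leqnn r) (valid m mM).
have := st (N + r).+1; rewrite (leq_trans n0N) ?(leq_trans (leq_addr r N))// => /(_ isT).
rewrite /loss_decreases /= leNgt => /negP; apply.
rewrite !big_add1 !big_mkord; apply: ltr_sum => [|m _].
  by apply/hasP; exists (Ordinal HMM).
rewrite !Hl !enorm_sq; apply: ltr_sum => [|i _].
  by apply/hasP; exists (Ordinal hd).
by rewrite !mxE; exact: incr.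
Qed.

Lemma gamma_cvg0_ae : \forall w \ae P, gamma n w @[n --> \oo] --> (0 : R).
Proof.
have := drops_ae; apply: filterS => w Hw.
apply: (@step_size_cvg0 _ nu (fun n => gamma n w) (loss_decreases w)) => // n n0.
- exact: Hgammastay.
- exact: Hgammadrop.
Qed.

(** * Passage to the limit in mean *)

Hypothesis Hnusum : (\sum_(1 <= k <oo) (nu k)%:E = +oo)%E.

Lemma partial_sum_ge (t : R) : exists L, t <= \sum_(1 <= k < L.+1) nu k.
Proof.
apply: contrapT => /forallNP H.
have Hlt n : \sum_(1 <= k < n.+1) nu k < t by rewrite ltNge; apply/negP/H.
suff : (\sum_(1 <= k <oo) (nu k)%:E <= t%:E)%E by rewrite Hnusum.
apply: lime_le.
  apply: is_cvg_nneseries => n n1 _; rewrite lee_fin.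
  by have /andP[/ltW] := Hnu01 n1.
exists 1%N => // -[//|n] _ /=.
by rewrite sumEFin lee_fin ltW.
Qed.

(** Dominated convergence with the constant bound 1, from the almost sure convergence of the step
    sizes. *)
Lemma mean_step_small (e : R) : 0 < e -> exists n,
  P.-integrable setT (EFin \o gamma n.+1) /\ (\int[P]_w (gamma n.+1 w)%:E <= e%:E)%E.
Proof.
move=> e0.
have mg n : measurable_fun setT (EFin \o gamma n.+1).
  by apply/measurable_EFinP; exact: Hgammarv.
have ig n : P.-integrable setT (EFin \o gamma n.+1).
  apply: (@le_integrable _ _ _ P setT measurableT _ (EFin \o cst 1)) => //.
    move=> w _; rewrite /= lee_fin normr1.
    by have /andP[g0 g1] := gamma01 n w; rewrite gtr0_norm// ltW.
  exact: finite_measure_integrable_cst.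
have [] := @dominated_convergence _ _ _ P setT measurableT
    (fun n => EFin \o gamma n.+1) (cst 0%E) (EFin \o cst 1) mg.
- exact: measurable_cst.
- have := gamma_cvg0_ae; apply: filterS => w gw _.
  have gw1 : gamma n.+1 w @[n --> \oo] --> (0 : R) by rewrite (cvg_shiftS (gamma ^~ w)).
  by apply/fine_cvgP; split; [exact: nearW|exact: gw1].
- exact: finite_measure_integrable_cst.
- apply: aeW => w n _; rewrite /= lee_fin.
  by have /andP[g0 g1] := gamma01 n w; rewrite gtr0_norm// ltW.
move=> _ _; rewrite integral_cst// mul0e => /fine_cvgP[_ /cvgrPdist_le /(_ e e0)].
case=> n _ /(_ n (leqnn n)) /=; rewrite sub0r normrN => h.
exists n; split => //.
have fi : (\int[P]_w (gamma n.+1 w)%:E)%E \is a fin_num by exact: (integrable_fin_num measurableT (ig n)).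
rewrite -(fineK fi) lee_fin.
exact: le_trans (ler_norm _) h.
Qed.

Lemma deviationS n w i : D n.+1 w i =
  (1 - 2 * gamma n.+1 w) * D n w i + 2 * gamma n.+1 w * xi n.+1 w i.
Proof. by rewrite /D /xi Theta_coordS; ring. Qed.

Lemma noise_bound n w i : `|xi n w i| <= b - a.
Proof.
have /andP[h1 h2] := batch_range n w i.
have /andP[h3 h4] := mean_range HXrv HXrange HXid i.
by rewrite ler_norml /xi; apply/andP; split; rewrite -/(mu i) in h3 h4; lra.
Qed.

Lemma integrable_sq_deviation0 : P.-integrable setT (EFin \o (fun w => \sum_i D 0 w i ^+ 2)).
Proof.
apply: (@le_integrable _ _ _ P setT measurableT _
  (EFin \o (fun w => 2 * enorm (Theta 0%N w) ^+ 2 + 2 * \sum_i mu i ^+ 2))).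
- apply/measurable_EFinP; apply: measurable_sum => i; apply: measurable_funX.
  by apply: measurable_funB; [exact: random_vector_coord|exact: measurable_cst].
- move=> w _; rewrite /= lee_fin ger0_norm ?sumr_ge0// => [|i _]; last exact: sqr_ge0.
  apply: le_trans (ler_norm _).
  rewrite enorm_sq !mulr_sumr -big_split /=; apply: ler_sum => i _.
  rewrite /D; have := sqr_ge0 (Theta 0%N w ord0 i + mu i); nra.
- have H := integrable_has_mean integrable_sq_Theta0.
  by have [] := has_meanD (has_meanZ 2 H) (has_mean_cst P (2 * \sum_i mu i ^+ 2)).
Qed.

Let meanv : 'rV[R]_d := \row_i mu i.

(** The order of the quantifiers matters: [c] and [A] do not depend on [n0], so [n0] can be chosen
    first to make the last term small, and [t] afterwards to suppress [C0]. *)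
Lemma mean_distance_bound : exists c A : R, 0 < c /\ 0 <= A /\
  forall n0, exists2 C0, 0 <= C0 & forall (t delta : R), 0 <= t -> 0 < delta ->
  (\int[P]_w (enorm (Theta (first_hit (gamma ^~ w) t) w - meanv))%:E <=
   (delta + delta^-1 * (expR (- (c * t)) * C0 +
      A * fine (\int[P]_w (gamma n0.+1 w)%:E)))%:E)%E.
Proof.
pose c := 4 * (1 - nu 1); pose K := expR c / c; pose B := #|'I_d|%:R * (b - a) ^+ 2.
have nu1 : nu 1 < 1 by have /andP[] := Hnu01 (ltn0Sn 0).
have c0 : 0 < c by rewrite mulr_gt0// subr_gt0.
have B0 : 0 <= B by rewrite mulr_ge0// sqr_ge0.
have K0 : 0 <= K by rewrite /K divr_ge0 ?expR_ge0// ltW.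
exists c, (4 * B * K * expR c); split => //; split.
  by apply: mulr_ge0; [apply: mulr_ge0 => //; exact: mulr_ge0|exact: expR_ge0].
move=> n0; pose C1 := 4 * B * (n0.+1%:R * expR (c * n0.+1%:R)).
pose q0 := fine (\int[P]_w (\sum_i D 0 w i ^+ 2)%:E)%E.
have q00 : 0 <= q0.
  rewrite fine_ge0// integral_ge0// => w _; rewrite lee_fin sumr_ge0// => i _; exact: sqr_ge0.
exists (q0 + C1) => [|t delta t0 delta0].
  apply: addr_ge0 => //; apply: mulr_ge0; first exact: mulr_ge0.
  by apply: mulr_ge0 => //; exact: expR_ge0.
have [L tL] := partial_sum_ge t.
pose F w := \sum_(1 <= k < L.+1) \sum_i
    ((S k.-1 w < t)%R%:R * (expR (c * S k w) * (4 * gamma k w * (1 - 2 * gamma k w)))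
       * D k.-1 w i) * xi k w i.
have HF : has_mean P F 0 by exact: (martingale_centered t L (ltW c0)).
(* An integrable pointwise majorant whose mean is explicit because [F] has mean zero. *)
pose U w := delta + delta^-1 * (expR (- (c * t)) * (\sum_i D 0 w i ^+ 2 + (F w + C1)) +
   4 * B * K * expR c * gamma n0.+1 w).
have ig : P.-integrable setT (EFin \o gamma n0.+1).
  apply: (@le_integrable _ _ _ P setT measurableT _ (EFin \o cst 1)).
  - by apply/measurable_EFinP; exact: Hgammarv.
  - move=> w _; rewrite /= lee_fin normr1.
    by have /andP[g0 g1] := gamma01 n0 w; rewrite gtr0_norm// ltW.
  - exact: finite_measure_integrable_cst.
have HU : has_mean P U (delta + delta^-1 * (expR (- (c * t)) * (q0 + (0 + C1)) +
   4 * B * K * expR c * fine (\int[P]_w (gamma n0.+1 w)%:E)%E)).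
  apply: has_meanD; first exact: has_mean_cst.
  apply: has_meanZ; apply: has_meanD; apply: has_meanZ; last exact: integrable_has_mean.
  apply: has_meanD; first exact: (integrable_has_mean integrable_sq_deviation0).
  by apply: has_meanD => //; exact: has_mean_cst.
case: HU => _; rewrite add0r => <-.
apply: le_ge0_integral => w; first by rewrite lee_fin enorm_ge0.
rewrite lee_fin; set N := first_hit _ _; set x := enorm _.
(* This form of [delta * x <= delta ^+ 2 + x ^+ 2] passes from the squared distance, which the
   energy controls, to the distance. *)
have hx : x <= delta + delta^-1 * x ^+ 2.
  rewrite -(ler_pM2l delta0) mulrDr mulVKf ?gt_eqF//.
  have := sqr_ge0 (x - delta); have := sqr_ge0 x; have := sqr_ge0 delta; nra.
apply: (le_trans hx); rewrite /U lerD2l ler_pM2l ?invr_gt0//.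
have -> : x ^+ 2 = \sum_i D N w i ^+ 2.
  by rewrite /x enorm_sq; apply: eq_bigr => i _; rewrite !mxE.
have SL : t <= S L w.
  apply: (le_trans tL); rewrite /S !big_add1 !big_mkord; apply: ler_sum => k _.
  apply: (@step_size_ge _ nu (fun n => gamma n w) (loss_decreases w)) => // j j0.
  - exact: Hgammastay.
  - exact: Hgammadrop.
rewrite (addrA _ (F w)).
apply: (@stopped_energy_bound _ 'I_d (fun n => gamma n w) (fun n => D n w) (fun n => xi n w)
  (nu 1) (b - a)) => //.
- move=> n n1; apply: (@step_size_gt0 _ nu (fun n => gamma n w) (loss_decreases w)) => // j j0.
  + exact: Hgammastay.
  + exact: Hgammadrop.
- move=> n m nm; apply: (@step_size_le _ nu (fun n => gamma n w) (loss_decreases w)) => // j j0.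
  + exact: Hgammastay.
  + exact: Hgammadrop.
- by move=> n i; exact: deviationS.
- by move=> n i; exact: noise_bound.
Qed.

Lemma mean_distance_limsup : limf_esup (fun t : R =>
  \int[P]_w (enorm (Theta (first_hit (gamma ^~ w) t) w - meanv))%:E)%E (pinfty_nbhs R) = 0%E.
Proof.
apply/eqP; rewrite eq_le; apply/andP; split; last first.
  apply: limf_esup_ge0 => [[m [_ /(_ (m + 1))]]|t]; first by rewrite ltrDl; apply.
  by apply: integral_ge0 => w _; rewrite lee_fin enorm_ge0.
apply/lee_addgt0Pr => e e0; rewrite add0e.
have [c [A [c0 [A0 H]]]] := mean_distance_bound.
(* With [e' = delta * delta], the final bound [delta + delta^-1 * (e' + e')] equals [e]. *)
pose delta := e / 3; have delta0 : 0 < delta by rewrite divr_gt0.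
pose e' := delta * delta; have e'0 : 0 < e' by rewrite mulr_gt0.
have [n0 [ig gn0]] : exists n, P.-integrable setT (EFin \o gamma n.+1) /\
    (\int[P]_w (gamma n.+1 w)%:E <= (e' / (A + 1))%:E)%E.
  by apply: mean_step_small; rewrite divr_gt0// ltr_wpDl.
have [C0 C00 {}H] := H n0.
have gb : A * fine (\int[P]_w (gamma n0.+1 w)%:E)%E <= e'.
  have h : fine (\int[P]_w (gamma n0.+1 w)%:E)%E <= e' / (A + 1).
    by rewrite -lee_fin fineK//; exact: (integrable_fin_num measurableT ig).
  apply: (le_trans (ler_wpM2l A0 h)); rewrite mulrCA ger_pMr//.
  by rewrite ler_pdivrMr ?ltr_wpDl// mul1r lerDl.
(* For [t > t0], [C0 <= e' * (c * t) <= e' * expR (c * t)]. *)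
pose t0 := C0 / (c * e').
have t00 : 0 <= t0 by rewrite divr_ge0// ltW// mulr_gt0.
rewrite limf_esupE.
apply: (@le_trans _ _ (ereal_sup [set (\int[P]_w
    (enorm (Theta (first_hit (gamma ^~ w) t) w - meanv))%:E)%E | t in [set t | t0 < t]])).
  apply: ereal_inf_lbound; exists [set t | t0 < t] => //.
  by exists t0; split => //; exact: num_real.
apply: ge_ereal_sup => _ [t /= tt0 <-].
have t_ge0 : 0 <= t by rewrite (le_trans t00)// ltW.
apply: (le_trans (H t delta t_ge0 delta0)); rewrite lee_fin.
have ht : expR (- (c * t)) * C0 <= e'.
  have h1 : C0 <= e' * expR (c * t).
    have h2 : C0 <= e' * (c * t).
      move: (ltW tt0); rewrite /t0 ler_pdivrMr ?mulr_gt0// => h3.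
      by rewrite mulrA mulrC [e' * c]mulrC.
    apply: (le_trans h2); rewrite ler_pM2l//.
    by apply: le_trans (expR_ge1Dx _); rewrite lerDr.
  have := ler_wpM2l (expR_ge0 (- (c * t))) h1.
  by rewrite mulrCA -expRD addNr expR0 mulr1.
have h : delta^-1 * (expR (- (c * t)) * C0 +
    A * fine (\int[P]_w (gamma n0.+1 w)%:E)%E) <= delta^-1 * (e' + e').
  by rewrite ler_pM2l ?invr_gt0// lerD.
have h' : delta^-1 * (e' + e') = delta + delta.
  by rewrite /e'; field; rewrite gt_eqF.
move: h; rewrite h' /delta => h; lra.
Qed.

End Descent.

Unset Implicit Arguments.
Set Strict Implicit.

Theorem theorem1p1 (R : realType) (d : nat) (hd : (0 < d)%N) (a b : R) (hab : a < b)
  (dT : measure_display) (T : measurableType dT) (P : probability T R)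
  (X : int -> int -> T -> 'rV[R]_d)
  (HXrv : forall n m, random_vector (X n m))
  (HXrange : forall n m w (i : 'I_d), a <= X n m w ord0 i <= b)
  (HXind : mutually_independent P
             (fun nm : int * int => rv_sigma (X nm.1 nm.2)))
  (HXid : forall n m B, @rV_borel R d B ->
             P (X n m @^-1` B) = P (X 0 0 @^-1` B))
  (Hsupp : forall x : 'rV[R]_d, (forall i, a <= x ord0 i <= b) ->
             forall eps : R, 0 < eps < 1 ->
             (0 < P [set w | (enorm (X 0%R 0%R w - x) < eps)%R])%E)
  (l : 'rV[R]_d -> 'rV[R]_d -> R)
  (Hl : forall theta x, l theta x = enorm (theta - x) ^+ 2)
  (M MM : nat) (HM : (0 < M)%N) (HMM : (0 < MM)%N)
  (Theta : nat -> T -> 'rV[R]_d) (gamma : nat -> T -> R)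
  (HThetarv : forall n, random_vector (Theta n))
  (Hgammarv : forall n, (0 < n)%N -> measurable_fun setT (gamma n))
  (HThetarec : forall n w, (0 < n)%N ->
     Theta n w = Theta n.-1 w - (gamma n w / M%:R) *:
       \sum_(1 <= m < M.+1) grad1 l (Theta n.-1 w) (X n%:Z m%:Z w))
  (HXTheta0 : independent2 P
     (<<s \bigcup_(nm in [set: int * int]) rv_sigma (X nm.1 nm.2) >>)
     (rv_sigma (Theta 0%N)))
  (HTheta0 : (\int[P]_w ((enorm (Theta 0%N w)) ^+ 2)%:E < +oo)%E)
  (nu : nat -> R)
  (Hnu01 : forall n, (0 < n)%N -> 0 < nu n < 1)
  (Hnudec : forall n m, (0 < n)%N -> (n < m)%N -> nu m < nu n)
  (Hnusum : (\sum_(1 <= k <oo) (nu k)%:E = +oo)%E)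
  (Hnulimsup : limn_esup (fun n => (nu n)%:E) = 0%E)
  (Hgamma1 : forall w, gamma 1%N w = nu 1%N)
  (Hgammastay : forall n w, (0 < n)%N ->
     \sum_(1 <= m < MM.+1) l (Theta n w) (X n%:Z (- m%:Z) w)
       <= \sum_(1 <= m < MM.+1) l (Theta n.-1 w) (X n%:Z (- m%:Z) w) ->
     gamma n.+1 w = gamma n w)
  (Hgammadrop : forall n w, (0 < n)%N ->
     \sum_(1 <= m < MM.+1) l (Theta n w) (X n%:Z (- m%:Z) w)
       > \sum_(1 <= m < MM.+1) l (Theta n.-1 w) (X n%:Z (- m%:Z) w) ->
     let S := [set x : R | (0 < x < gamma n w) /\
                           exists k, (0 < k)%N /\ x = nu k] in
     S (gamma n.+1 w) /\ forall y, S y -> y <= gamma n.+1 w) :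
  limf_esup
    (fun t : R =>
       (\int[P]_w (enorm (Theta (first_hit (fun k => gamma k w) t) w
                  - \row_(i < d) Rintegral P setT (fun w' => X 1 1 w' ord0 i)))%:E)%E)
    (pinfty_nbhs R) = 0%E.
Proof.
apply: (@mean_distance_limsup R d a b dT T P X l M MM Theta gamma nu HXrv HXrange HXind HXid
  Hl HM HMM HThetarv Hgammarv HThetarec HXTheta0 HTheta0 Hnu01 Hnudec Hgamma1) => //.
- move=> n w n0; rewrite /loss_decreases -ltNge; exact: Hgammadrop.
Qed.
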